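(* Suppose that $J$ is positive-definite and $J^{-1}$ is a trace class operator. Then for every eigenvalue $\zeta$ of $J$, a corresponding eigenvector can be chosen as the column vector $$\big(w(0)\mathfrak{F}^{[1]}(\zeta),\;w_1(0)\mathfrak{F}^{[2]}(\zeta),\;w_2(0)\mathfrak{F}^{[3]}(\zeta),\;\ldots\big)^{T}.$$
   Context: $(\boldsymbol e_n)_{n\ge0}$ is the standard basis of $\ell^2(\mathbb{N}_0)$, $\mathbb{N}_0=\{0,1,2,\dots\}$. Let $(a_n)_{n\ge0}$ be positive numbers, $(b_n)_{n\ge0}$ real numbers, and $\mathcal{J}$ the infinite symmetric tridiagonal matrix with $\mathcal{J}_{n,n}=b_n$, $\mathcal{J}_{n,n+1}=\mathcal{J}_{n+1,n}=a_n$. The Jacobi operator $J$ is the closure in $\ell^2(\mathbb{N}_0)$ of the action of $\mathcal{J}$ on finitely supported sequences. It is assumed that $J$ is positive-definite and that $J^{-1}$ is a trace class operator on $\ell^2(\mathbb{N}_0)$; in particular $J$ is self-adjoint, $0$ is in its resolvent set, and its spectrum consists of simple positive eigenvalues tending to $\infty$. The functions of the second kind are $w_k(z)=\langle\boldsymbol e_k,(J-zI)^{-1}\boldsymbol e_0\rangle$, $k\ge0$, and $w(z)=w_0(z)$. For $m\ge1$, $J^{[m]}$ is the Jacobi operator obtained from $J$ by removing the first $m$ rows and columns of the matrix; it is known to satisfy the same assumptions (positive-definite with trace class inverse). Its characteristic function is the entire function $\mathfrak{F}^{[m]}(z)=\prod_{n\ge1}(1-z/\zeta_n^{[m]})$,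 where $0<\zeta_1^{[m]}<\zeta_2^{[m]}<\cdots$ are the eigenvalues of $J^{[m]}$. *)

(* Defs.v *)
From mathcomp Require Import all_boot all_order all_algebra.
From mathcomp Require Import complex.
From mathcomp Require Import all_classical all_reals all_analysis.
Import Order.TTheory GRing.Theory Num.Theory.
Import numFieldNormedType.Exports.

Set Implicit Arguments.
Unset Strict Implicit.
Unset Printing Implicit Defensive.

Local Open Scope classical_set_scope.
Local Open Scope ring_scope.
Local Open Scope complex_scope.

(* Complex sequences; [R[i]^o] is [R[i]] with its canonical topology and its
   module structure over itself. *)
Notation cseq R := (nat -> R[i]^o).

(** ** The Hilbert space l2 over the complex numbers *)

Definition l2 (R : realType) : set (cseq R) :=
  [set x | cvgn (series (fun n => Normc.normc (x n) ^+ 2))].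

Definition l2norm (R : realType) (x : cseq R) : R :=
  Num.sqrt (limn (series (fun n => Normc.normc (x n) ^+ 2))).

(* Antilinear in the first argument. *)
Definition dot (R : realType) (x y : cseq R) : R[i] :=
  limn (series (fun n => (x n)^* * y n : R[i]^o)).

Definition basis_vec (R : realType) (k : nat) : cseq R :=
  fun n => (n == k)%:R.

Definition finitely_supported (R : realType) (x : cseq R) : Prop :=
  exists N : nat, forall n : nat, (N <= n)%N -> x n = 0.

(** ** Bounded and trace class operators on l2 *)

(* Everywhere defined operators on l2 are functions on sequences of which only
   the restriction to l2 matters. *)
Definition bounded_operator (R : realType) (T : cseq R -> cseq R) : Prop :=
  [/\ forall x, l2 x -> l2 (T x),
      forall (c : R[i]) x y, l2 x -> l2 y -> T (c *: x + y) = c *: T x + T y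
    & exists M : R, forall x, l2 x -> l2norm (T x) <= M * l2norm x].

(* [P] is the positive square root of [T^* T].  The order of [R[i]] makes
   [0 <= dot x (P x)] include that [dot x (P x)] is real, so that [P] is
   self-adjoint and the last clause reads [P^2 = T^* T]. *)
Definition absolute_value (R : realType) (T P : cseq R -> cseq R) : Prop :=
  [/\ bounded_operator P,
      forall x, l2 x -> 0 <= dot x (P x)
    & forall x y, l2 x -> l2 y -> dot (P x) (P y) = dot (T x) (T y)].

Definition trace_class (R : realType) (T : cseq R -> cseq R) : Prop :=
  bounded_operator T /\
  exists P : cseq R -> cseq R, absolute_value T P /\
    cvgn (series (fun n => dot (basis_vec R n) (P (basis_vec R n)) : R[i]^o)).

(** ** Unbounded operators *)

(* An unbounded operator is given by its graph: [A x y] means that [x] is in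
   the domain of [A] and that [A x = y]. *)
Definition operator (R : realType) := cseq R -> cseq R -> Prop.

Definition positive_definite (R : realType) (A : operator R) : Prop :=
  forall x y, A x y -> x <> 0 -> 0 < dot x y.

Definition is_inverse (R : realType) (A : operator R)
    (T : cseq R -> cseq R) : Prop :=
  (forall y, l2 y -> A (T y) y) /\ (forall x y, A x y -> T y = x).

Definition inverse_trace_class (R : realType) (A : operator R) : Prop :=
  exists T : cseq R -> cseq R, is_inverse A T /\ trace_class T.

Definition is_eigenvector (R : realType) (A : operator R) (zeta : R[i])
    (x : cseq R) : Prop :=
  x <> 0 /\ A x (zeta *: x).

Definition is_eigenvalue (R : realType) (A : operator R) (zeta : R[i]) : Prop :=
  exists x, is_eigenvector A zeta x.

(* [(A - z)^-1 y]; meaningful for [z] in the resolvent set and [y] in l2. *)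
Definition resolvent (R : realType) (A : operator R) (z : R[i])
    (y : cseq R) : cseq R :=
  xget 0 [set x | A x (y + z *: x)].

(* [s 0 < s 1 < ...] are the eigenvalues of [A]. *)
Definition enumerates_eigenvalues (R : realType) (A : operator R)
    (s : nat -> R) : Prop :=
  (forall n, s n < s n.+1) /\
  (forall zeta : R[i], is_eigenvalue A zeta <-> exists n, zeta = (s n)%:C).

(* The enumeration is unique when it exists; the default value is irrelevant
   for a positive-definite operator with compact inverse. *)
Definition eigenvalue_seq (R : realType) (A : operator R) : nat -> R :=
  xget (fun=> 0) [set s | enumerates_eigenvalues A s].

(* [eigenvalue_seq A n] is the (n+1)-st eigenvalue, so the product over all
   natural numbers [n] is the product over all eigenvalues. *)
Definition char_function (R : realType) (A : operator R) (z : R[i]) : R[i] :=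
  limn (fun N => \prod_(n < N) (1 - z / (eigenvalue_seq A n)%:C) : R[i]^o).

(** ** Jacobi operators *)

Definition jacobi_matrix_action (R : realType) (a b : nat -> R)
    (x : cseq R) : cseq R :=
  fun n => (if n is n'.+1 then (a n')%:C * x n' else 0)
           + (b n)%:C * x n + (a n)%:C * x n.+1.

(* The closure in l2 x l2 of the graph of the matrix action on finitely
   supported sequences. *)
Definition jacobi (R : realType) (a b : nat -> R) : operator R :=
  fun x y => [/\ l2 x, l2 y &
    exists u : nat -> cseq R,
      [/\ forall i, finitely_supported (u i),
          (fun i => l2norm (u i - x)) @ \oo --> (0 : R)
        & (fun i => l2norm (jacobi_matrix_action a b (u i) - y)) @ \oo
            --> (0 : R)]].

(* The first [m] rows and columns of the matrix are removed. *)
Definition jacobi_shift (R : realType) (a b : nat -> R) (m : nat) :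
    operator R :=
  jacobi (fun n => a (n + m)%N) (fun n => b (n + m)%N).

Definition second_kind (R : realType) (a b : nat -> R) (k : nat)
    (z : R[i]) : R[i] :=
  dot (basis_vec R k) (resolvent (jacobi a b) z (basis_vec R 0)).

(* Main.v *)
Require Import Defs.
From mathcomp Require Import all_boot all_order all_algebra.
From mathcomp Require Import complex polyrcf.
From mathcomp Require Import all_classical all_reals all_analysis.
From mathcomp Require Import ring lra zify.
Import Order.TTheory GRing.Theory Num.Theory.
Import numFieldNormedType.Exports.

(* Let [D m n] be the determinant of [J - z] restricted to the rows and columns
   [m, ..., m + n - 1]. Its roots are real and interlace with those of
   [D m n.+1] and [D m.-1 n.+1], so the inverse roots increase with [n]; their
   sum is the trace of the inverse of a finite section of [J], which is at most
   [sum_k <e_k, J^-1 e_k>]. By dominated convergence [D m n (z) / D m n (0)]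
   tends to [F_m (z) = prod_i (1 - z l_i)], where the [l_i] are the limits of
   the inverse roots.
   The three-term recurrence of the determinants then gives a relation between
   [F_m], [F_(m+1)] and [F_(m+2)], by which [phi_k = w_k(0) F_(k+1) (z)] is a
   square-summable solution of [J phi = z phi + F_0 (z) e_0]. Hence the zeros of
   [F_0] are exactly the eigenvalues of [J], so that [F_0] is the characteristic
   function, and [phi] is an eigenvector at each of them. The same applies to
   every [J^[m]]. *)

Set Implicit Arguments.
Unset Strict Implicit.
Unset Printing Implicit Defensive.
Local Open Scope ring_scope.
Local Open Scope classical_set_scope.
Local Open Scope complex_scope.

(** The operator theory is squeezed into [finite_bounds], inequalities about finitely supported real
    sequences only. A vector supported on the rows [m, ..., m + n - 1] serves [J] and [J^[m]] alike,
    so one set of bounds, with the tails of one convergent series, controls every shift at once and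
    forces [F_m] to tend to 1; this limit excludes a common zero of two consecutive [F_m]. The trace
    class hypothesis speaks of an absolute value [P] of the inverse [T], whereas the determinants
    see the diagonal of [T]. The passage needs [T <= P] as quadratic forms, which is derived from
    [|T x| = |P x|] and the positivity of [P] by a direct argument on forms. Two facts tie the
    limits back to the closed operator. Because [J] has an everywhere defined inverse, its domain
    contains every square-summable sequence with square-summable image, hence [phi]. And an
    eigenvector [x] paired with [x_0 phi] gives [F_0(z) |x_0|^2 = 0], so that every eigenvalue is a
    zero of [F_0]. Eigenvalues are real, so only real [z] has to be treated, and l2 is handled as a
    real Hilbert space. *)

Local Notation Re := (@complex.Re _).
Local Notation Im := (@complex.Im _).
Local Notation act := jacobi_matrix_action.

(** * Three-term recurrences and interlacing roots *)

Section ThreeTerm.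
Variable R : rcfType.

Lemma poly_neg_at_ninfty (p : {poly R}) (M : R) :
  0 < (-1) ^+ (size p).-1 * lead_coef p -> exists2 x, x < M & 0 < p.[x].
Proof.
move=> lp.
have sz : size (- 'X : {poly R}) = 2 by rewrite size_polyN size_polyX.
have lq : lead_coef (p \Po (- 'X)) = (-1) ^+ (size p).-1 * lead_coef p.
  by rewrite lead_coef_comp ?sz // lead_coefN lead_coefX mulrC.
have [n hn] := poly_pinfty_gt_lc (p := p \Po (- 'X)) ltac:(by rewrite lq).
pose y := Num.max n (1 - M).
exists (- y); first by rewrite ltrNl lt_max; apply/orP; right; lra.
have := hn y; rewrite le_max lexx => /(_ isT).
by rewrite horner_comp hornerN hornerX lq; apply: lt_le_trans.
Qed.

Lemma sgn_gt0_at_pinfty (p : {poly R}) (k : nat) (M : R) :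
  0 < (-1) ^+ k * lead_coef p -> exists2 x, M < x & 0 < (-1) ^+ k * p.[x].
Proof.
move=> lp.
have lq : lead_coef ((-1) ^+ k *: p) = (-1) ^+ k * lead_coef p.
  by rewrite lead_coefZ.
have [n hn] := poly_pinfty_gt_lc (p := (-1) ^+ k *: p) ltac:(by rewrite lq).
pose y := Num.max n (M + 1).
exists y; first by rewrite lt_max; apply/orP; right; lra.
have := hn y; rewrite le_max lexx => /(_ isT).
by rewrite hornerZ lq; apply: lt_le_trans.
Qed.

Definition incr_below (n : nat) (r : nat -> R) :=
  forall i, (i.+1 < n)%N -> r i < r i.+1.

Definition interlace (n : nat) (r s : nat -> R) :=
  forall i, (i < n)%N -> s i < r i < s i.+1.

(** The factors are [r i - X], not [X - r i], to match the leading sign of [det (J - X)]; the value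
    at 0 is then the product of the roots. *)
Definition prod_roots (n : nat) (r : nat -> R) : {poly R} :=
  \prod_(i < n) ((r i)%:P - 'X).

Lemma incr_below_lt n r i j :
  incr_below n r -> (i < j)%N -> (j < n)%N -> r i < r j.
Proof.
move=> rP; elim: j => // j IHj; rewrite ltnS leq_eqVlt => /orP[/eqP->|ij] jn.
  exact: rP.
by apply: lt_trans (rP _ jn); apply: IHj => //; apply: ltnW.
Qed.

Lemma incr_below_le n r i j :
  incr_below n r -> (i <= j)%N -> (j < n)%N -> r i <= r j.
Proof.
move=> rP; rewrite leq_eqVlt => /orP[/eqP->|ij] jn //.
by rewrite ltW // (incr_below_lt rP).
Qed.

Lemma horner_prod_roots n r x :
  (prod_roots n r).[x] = \prod_(i < n) (r i - x).
Proof. by rewrite horner_prod; apply: eq_bigr => i _; rewrite !hornerE. Qed.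

(** By interlacing exactly the [r j] with [j < i] lie below [s i], so exactly [i] factors are
    negative. *)
Lemma prod_roots_interlace_sgn n r s i : incr_below n.+1 s ->
  interlace n r s -> (i <= n)%N -> 0 < (-1) ^+ i * (prod_roots n r).[s i].
Proof.
move=> sP rs le_in; rewrite horner_prod_roots.
have -> : (-1) ^+ i = \prod_(j < n) (if (j < i)%N then -1 else 1) :> R.
  rewrite -[in LHS](minn_idPl le_in); elim: {le_in sP rs}n => [|n IHn].
    by rewrite minn0 big_ord0.
  rewrite big_ord_recr /= -IHn; case: ltnP => h; last by rewrite mulr1; congr (_ ^+ _); lia.
  by rewrite -exprSr; congr (_ ^+ _); lia.
rewrite -big_split /=; apply: prodr_gt0 => j _; have /andP[h1 h2] := rs j (ltn_ord j).
case: ifPn => ji.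
  have : r j < s i by apply: lt_le_trans h2 _; apply: (incr_below_le sP).
  by lra.
have : s i < r j.
  by apply: le_lt_trans h1; apply: (incr_below_le sP); have := ltn_ord j; lia.
by lra.
Qed.

Lemma prod_rootsS n r : prod_roots n.+1 r = prod_roots n r * ((r n)%:P - 'X).
Proof. by rewrite /prod_roots big_ord_recr. Qed.

Lemma prod_rootsE n r :
  prod_roots n r = (-1) ^+ n *: \prod_(i < n) ('X - (r i)%:P).
Proof.
elim: n => [|n IHn]; first by rewrite /prod_roots !big_ord0 scale1r.
rewrite prod_rootsS IHn big_ord_recr /= exprS mulN1r scaleNr -scalerAl.
by rewrite -scalerN -mulrN opprB.
Qed.

Lemma prod_rootsP n r (p : {poly R}) : size p = n.+1 ->
  lead_coef p = (-1) ^+ n -> incr_below n r ->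
  (forall i, (i < n)%N -> root p (r i)) -> p = prod_roots n r.
Proof.
move=> sp lp rP pr.
have uq : uniq [seq r i | i <- iota 0 n].
  apply/(uniqP 0) => i j; rewrite !inE size_map size_iota => i_n j_n.
  rewrite !(nth_map 0%N) ?size_iota // !nth_iota // !add0n.
  case: (ltngtP i j) => // ij e.
    by have := incr_below_lt rP ij j_n; rewrite e ltxx.
  by have := incr_below_lt rP ij i_n; rewrite e ltxx.
rewrite prod_rootsE [LHS](@all_roots_prod_XsubC _ _ [seq r i | i <- iota 0 n]) //.
- by rewrite lp big_map -[in RHS](big_mkord predT (fun i => 'X - (r i)%:P)) /index_iota subn0.
- by rewrite size_map size_iota.
- by rewrite all_map; apply/allP => i; rewrite mem_iota => /andP[_ i_n]; exact: pr.
- by rewrite uniq_rootsE.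
Qed.

Variables (al be : nat -> R).
Hypothesis al_gt0 : forall n, 0 < al n.

(** Characteristic determinants of a Jacobi matrix, [al] being the squares of its off-diagonal
    entries. With abstract coefficients one interlacing theorem covers sections that grow at the
    last row and, read backwards, sections that grow at the first. *)
Fixpoint three_term (n : nat) : {poly R} :=
  match n with
  | 0 => 1
  | n'.+1 => ((be n')%:P - 'X) * three_term n'
             - match n' with 0 => 0 | n''.+1 => al n'' *: three_term n'' end
  end.

Lemma three_termSS n : three_term n.+2 =
  ((be n.+1)%:P - 'X) * three_term n.+1 - al n *: three_term n.
Proof. by []. Qed.

Lemma three_term_lead n :
  size (three_term n) = n.+1 /\ lead_coef (three_term n) = (-1) ^+ n.
Proof.
have lin c : size (c%:P - 'X : {poly R}) = 2 /\ lead_coef (c%:P - 'X : {poly R}) = -1.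
  by rewrite -opprB size_polyN size_XsubC lead_coefN lead_coefXsubC.
elim/ltn_ind: n => -[|[|n]] IH.
- by rewrite /= size_poly1 lead_coef1.
- by rewrite /= mulr1 subr0; apply: lin.
have [sn ln] := IH n.+1 (ltnSn _); have [sn' _] := IH n (ltnW (ltnSn _)).
have [s2 l2] := lin (be n.+1).
rewrite three_termSS.
set p := _ * _; set q := _ *: _.
have sp : size p = n.+3.
  rewrite /p size_Mmonic' // || rewrite size_mul ?s2 ?sn //.
    by rewrite -size_poly_gt0 s2.
  by rewrite -size_poly_gt0 sn.
have sq : (size (- q) < size p)%N.
  by rewrite sp size_polyN (leq_ltn_trans (size_scale_leq _ _)) // sn'.
by rewrite size_polyDl // lead_coefDl // sp /p lead_coefM l2 ln -exprS.
Qed.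

Definition root_enum (n : nat) (p : {poly R}) (r : nat -> R) :=
  incr_below n r /\ p = prod_roots n r.

Lemma root_enum_inj n p r s :
  root_enum n p r -> root_enum n p s -> forall i, (i < n)%N -> r i = s i.
Proof.
move=> [rP pr] [sP ps].
pose l (f : nat -> R) := [seq f i | i <- iota 0 n].
have srt f : incr_below n f -> sorted <%R (l f).
  move=> fP; apply/(sortedP 0) => i; rewrite size_map size_iota => i_n.
  by rewrite !(nth_map 0%N) ?size_iota ?nth_iota //; [apply: fP | apply: ltnW..].
have mm f : p = prod_roots n f -> l f =i root p.
  move=> pf x; have -> : (x \in root p) = (p.[x] == 0) by [].
  rewrite pf horner_prod_roots prodf_seq_eq0.
  apply/mapP/hasP => [[k]|[i _ /=]].
    rewrite mem_iota /= add0n => k_n ->; exists (Ordinal k_n); rewrite ?mem_index_enum //=.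
    by rewrite subrr eqxx.
  by rewrite subr_eq0 => /eqP fx; exists i => //; rewrite mem_iota /=.
have e : l r = l s.
  apply: (irr_sorted_eq lt_trans ltxx (srt _ rP) (srt _ sP)) => x.
  by rewrite mm // mm.
move=> i i_n; have := congr1 (nth 0 ^~ i) e.
by rewrite !(nth_map 0%N) ?size_iota ?nth_iota.
Qed.

(** At a root [s i] of the polynomial of degree [n + 1] the recurrence reduces the next polynomial
    to [- al n] times the previous one, whose sign there alternates with [i] by induction. Together
    with the signs near the two infinities this yields [n + 2] sign changes. *)
Lemma three_term_interlace n : exists r s,
  [/\ root_enum n (three_term n) r, root_enum n.+1 (three_term n.+1) s
    & interlace n r s].
Proof.
elim: n => [|n [r [s [[rP pr] [sP ps] rs]]]].
  exists (fun=> 0), (fun=> be 0); split => //.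
    by split => //; rewrite /prod_roots big_ord0.
  by split => //; rewrite /prod_roots big_ord1 /= mulr1 subr0.
pose q := three_term n.+2.
have [sq lq] := three_term_lead n.+2.
have qs i : (i <= n)%N -> 0 < (-1) ^+ i.+1 * q.[s i].
  move=> i_n; rewrite /q three_termSS hornerD hornerN hornerM hornerZ ps (horner_prod_roots n.+1).
  rewrite (bigD1 (Ordinal (i_n : (i < n.+1)%N))) //= subrr mul0r mulr0 add0r.
  rewrite exprS mulN1r mulrNN mulrCA pmulr_rgt0 // pr.
  exact: prod_roots_interlace_sgn.
have [xm xm_lt qxm] : exists2 x, x < s 0 & 0 < q.[x].
  by apply: poly_neg_at_ninfty; rewrite sq lq -expr2 sqrr_sign.
have [xp xp_gt qxp] : exists2 x, s n < x & 0 < (-1) ^+ n.+2 * q.[x].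
  by apply: sgn_gt0_at_pinfty; rewrite lq -expr2 sqrr_sign.
(* The [n + 3] sample points in increasing order: [xm], then [s 0, ..., s n], then [xp]. *)
pose y i := if i is i'.+1 then if (i' <= n)%N then s i' else xp else xm.
have yinc i : (i < n.+2)%N -> y i < y i.+1.
  case: i => [|i] /= i_n; first by [].
  rewrite ltnS in i_n; have -> : (i <= n)%N by lia.
  by case: ifPn => // si_n; [apply: sP | have -> : i = n by lia].
have yq i : (i <= n.+2)%N -> 0 < (-1) ^+ i * q.[y i].
  case: i => [|i] /= i_n; first by rewrite expr0 mul1r.
  case: ifPn => // si_n; first exact: qs.
  by have -> : i = n.+1 by lia.
have rt i : {x : R | (i < n.+2)%N -> (y i < x < y i.+1) && root q x}.
  case: (boolP (i < n.+2)%N) => i_n; last by exists 0.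
  have [] := @poly_ivtoo _ q (y i) (y i.+1).
  - exact/ltW/yinc.
  - have h1 := yq i.+1 i_n. have h0 := yq i (ltnW i_n).
    have : 0 < ((-1) ^+ i * q.[y i]) * ((-1) ^+ i.+1 * q.[y i.+1]) by apply: mulr_gt0.
    rewrite exprS mulN1r mulNr mulrN mulrACA -expr2 sqrr_sign mul1r; lra.
  by move=> x; rewrite in_itv /= => xy rx; exists x => _; rewrite xy.
pose u i := sval (rt i).
have uP i : (i < n.+2)%N -> (y i < u i < y i.+1) && root q (u i) := svalP (rt i).
have uinc : incr_below n.+2 u.
  move=> i i_n; have /andP[/andP[_ h1] _] := uP i (ltnW i_n).
  by have /andP[/andP[h2 _] _] := uP i.+1 i_n; apply: lt_trans h2.
exists s, u; split; first by [].
  split => //; apply: prod_rootsP => // i i_n.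
  by have /andP[] := uP i i_n.
move=> i i_n; have /andP[/andP[_ h1] _] := uP i (ltnW i_n).
have /andP[/andP[h2 _] _] := uP i.+1 i_n.
by move: h1 h2 => /=; rewrite -ltnS i_n => -> ->.
Qed.

End ThreeTerm.

(** * Determinants of the diagonal blocks of the Jacobi matrix *)

Section Continuants.
Variables (R : rcfType) (a b : nat -> R).

(** The index is shifted by one: [cont m n.+1] is the determinant of the block of size [n] that
    starts at row [m]. The value 0 at index 0 stands for size -1 and lets the recurrences hold from
    size 1 on. *)
Fixpoint cont (m n : nat) : {poly R} :=
  match n with
  | 0 => 0
  | 1 => 1
  | (n'.+1 as n1).+1 =>
      ((b m)%:P - 'X) * cont m.+1 n1 - (a m ^+ 2)%:P * cont m.+2 n'
  end.

Arguments cont : simpl never.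

Lemma cont0 m : cont m 0 = 0. Proof. by []. Qed.

Lemma cont1 m : cont m 1 = 1. Proof. by []. Qed.

Lemma cont_front m n : cont m n.+2 =
  ((b m)%:P - 'X) * cont m.+1 n.+1 - (a m ^+ 2)%:P * cont m.+2 n.
Proof. by []. Qed.

Lemma horner_cont_front m n x : (cont m n.+2).[x] =
  (b m - x) * (cont m.+1 n.+1).[x] - a m ^+ 2 * (cont m.+2 n).[x].
Proof.
rewrite cont_front; move: (cont m.+1 n.+1) (cont m.+2 n) => p q.
by rewrite !(hornerD, hornerN, hornerM, hornerC, hornerX).
Qed.

(** The block is cut before row [m + k]; only the off-diagonal entry [a (m + k).-1] couples the two
    parts. For [k = 0] the truncated predecessor is harmless, since [cont m 0 = 0]. *)
Lemma cont_split m k l : cont m (k + l).+1 =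
  cont m k.+1 * cont (m + k) l.+1
  - (a (m + k).-1 ^+ 2)%:P * cont m k * cont (m + k).+1 l.
Proof.
elim/ltn_ind: k m => -[|[|k]] IH m.
- by rewrite cont0 cont1 mulr0 mul0r subr0 mul1r addn0.
- rewrite add1n cont_front addn1 [cont m 2]cont_front.
  by rewrite !cont1 cont0 mulr0 subr0 !mulr1.
rewrite !addSn cont_front -addSn. rewrite (IH k.+1) //. rewrite (IH k) //.
have -> : (m.+1 + k.+1 = m + k.+2)%N by lia.
have -> : (m.+2 + k = m + k.+2)%N by lia.
rewrite [cont m k.+3]cont_front [cont m k.+2]cont_front.
move: (cont m.+1 k.+2) (cont m.+2 k.+1) (cont m.+1 k.+1) (cont m.+2 k).
move: (cont (m + k.+2) l.+1) (cont (m + k.+2).+1 l) (_ ^+ 2)%:P (_ ^+ 2)%:P (_ - _).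
by move=> *; ring.
Qed.

Lemma cont_back m n : cont m n.+2 =
  ((b (m + n))%:P - 'X) * cont m n.+1 - (a (m + n).-1 ^+ 2)%:P * cont m n.
Proof.
have := cont_split m n 1; rewrite addn1 => ->.
by rewrite [cont _ 2]cont_front cont0 !cont1 mulr0 subr0 !mulr1 mulrC.
Qed.

(** Jacobi's formula: each summand is the principal minor left after deleting row and column
    [m + k], which falls apart into a block before and a block after that row. *)
Lemma deriv_cont m n : deriv (cont m n.+1) =
  - \sum_(k < n) cont m k.+1 * cont (m + k).+1 (n - k).
Proof.
elim/ltn_ind: n m => -[|[|n]] IH m.
- by rewrite cont1 derivC big_ord0 oppr0.
- rewrite cont_front cont0 cont1 mulr1 mulr0 subr0 derivD derivN derivX derivC sub0r.
  by rewrite big_ord1 /= !cont1 mulr1.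
rewrite cont_front derivB !derivM derivB derivX !derivC !mul0r !add0r.
rewrite IH // IH // [in RHS]big_ord_recl /= cont1 mul1r addn0 subn0.
rewrite [X in _ = - (_ + X)](_ : _ =
  ((b m)%:P - 'X) * \sum_(i < n.+1) cont m.+1 i.+1 * cont (m.+1 + i).+1 (n.+1 - i)
  - (a m ^+ 2)%:P * \sum_(i < n) cont m.+2 i.+1 * cont (m.+2 + i).+1 (n - i)).
  by ring.
rewrite [in RHS]mulr_sumr [X in _ = _ - _ * X](_ : _ =
    \sum_(i < n.+1) cont m.+2 i * cont (m.+1 + i).+1 (n.+1 - i)); last first.
  rewrite big_ord_recl /= cont0 mul0r add0r; apply: eq_bigr => i _.
  by rewrite /bump /= add1n subSS addnS.
rewrite mulr_sumr -sumrB; apply: eq_bigr => i _.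
rewrite /bump /= add1n subSS addnS addSn.
by rewrite [cont m i.+2]cont_front mulrBl !mulrA.
Qed.

Hypothesis a_gt0 : forall n, 0 < a n.

Lemma cont_three_term m n : cont m n.+1 =
  three_term (fun j => a (m + j)%N ^+ 2) (fun j => b (m + j)%N) n.
Proof.
elim/ltn_ind: n => -[|[|n]] IH //.
  by rewrite cont_front /= addn0 cont0 cont1 !mulr1 mulr0.
by rewrite three_termSS cont_back !IH // mul_polyC !addnS.
Qed.

(** The last row [N] stays fixed and the matrix is read from it upwards, so that adding a first row
    becomes a step of [three_term]. *)
Lemma cont_three_term_rev N n : (n <= N.+1)%N -> cont (N.+1 - n) n.+1 =
  three_term (fun j => a (N.-1 - j)%N ^+ 2) (fun j => b (N - j)%N) n.
Proof.
elim/ltn_ind: n => -[|[|n]] IH n_le //.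
  by rewrite subSS subn0 cont_front /= cont0 cont1 !mulr1 mulr0 subn0.
rewrite three_termSS cont_front -!IH // ?mul_polyC; try lia.
have -> : (N.+1 - n.+2).+1 = (N.+1 - n.+1)%N by lia.
have -> : (N.+1 - n.+1).+1 = (N.+1 - n)%N by lia.
by congr (((b _)%:P - _) * _ - (a _ ^+ 2) *: _); lia.
Qed.

Lemma cont_roots m n : exists r, root_enum n (cont m n.+1) r.
Proof.
have [r [s [h _ _]]] := three_term_interlace (fun j => b (m + j)%N)
  (fun j => exprn_gt0 2 (a_gt0 (m + j)%N)) n.
by exists r; rewrite cont_three_term.
Qed.

Lemma interlace_eq n p q r s r' s' :
  root_enum n p r -> root_enum n.+1 q s -> interlace n r s ->
  root_enum n p r' -> root_enum n.+1 q s' -> interlace (R := R) n r' s'.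
Proof.
move=> hr hs rs hr' hs' i i_n.
rewrite -(root_enum_inj hr hr') // -!(root_enum_inj hs hs') //; first exact: rs.
exact: ltnW.
Qed.

Lemma cont_interlace_back m n r s : root_enum n (cont m n.+1) r ->
  root_enum n.+1 (cont m n.+2) s -> interlace n r s.
Proof.
rewrite !cont_three_term; have [r' [s' [hr hs rs]]] := three_term_interlace
  (fun j => b (m + j)%N) (fun j => exprn_gt0 2 (a_gt0 (m + j)%N)) n.
exact: interlace_eq rs.
Qed.

Lemma cont_interlace_front m n r s : root_enum n (cont m.+1 n.+1) r ->
  root_enum n.+1 (cont m n.+2) s -> interlace n r s.
Proof.
have [r' [s' [hr hs rs]]] := three_term_interlace (fun j => b (m + n - j)%N)
  (fun j => exprn_gt0 2 (a_gt0 ((m + n).-1 - j)%N)) n.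
have e1 := @cont_three_term_rev (m + n) n ltac:(lia).
have e2 := @cont_three_term_rev (m + n) n.+1 ltac:(lia).
rewrite (_ : (_ - _)%N = m.+1) in e1; last by lia.
rewrite (_ : (_ - _)%N = m) in e2; last by lia.
rewrite e1 e2; exact: interlace_eq rs.
Qed.

(** The logarithmic derivative at 0, up to sign. *)
Lemma sum_inv_roots n r : (forall i, (i < n)%N -> r i != 0) ->
  \sum_(i < n) (r i)^-1 = - (deriv (prod_roots n r)).[0] / (prod_roots n r).[0] :> R.
Proof.
elim: n => [|n IH] r0; first by rewrite /prod_roots !big_ord0 derivC horner0 oppr0 mul0r.
rewrite big_ord_recr /= IH; last by move=> i i_n; apply: r0; apply: ltnW.
have p0 : (prod_roots n r).[0] != 0.
  by rewrite horner_prod_roots; apply/prodf_neq0 => i _; rewrite subr0 r0 // ltnS ltnW.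
rewrite prod_rootsS derivM derivB derivX derivC !hornerE.
by field; rewrite p0 r0.
Qed.

End Continuants.
Arguments cont {R} a b m n : simpl never.

(** * The real inner product of l2 *)

Section ComplexLimits.
Variable R : realType.
Implicit Types (u : cseq R) (z w : R[i]).

Lemma normc_sqr z : Normc.normc z ^+ 2 = Re z ^+ 2 + Im z ^+ 2.
Proof. by case: z => x y /=; rewrite sqr_sqrtr // addr_ge0 // sqr_ge0. Qed.

Lemma cvg_complex u z : Re (u n) @[n --> \oo] --> Re z ->
  Im (u n) @[n --> \oo] --> Im z -> u @ \oo --> (z : R[i]^o).
Proof.
move=> h1 h2; apply/cvgrPdist_lt => e e0.
(* The order of [R[i]] compares only numbers with equal imaginary parts, so a positive [e] is
   real. *)
have ee : e = (Re e)%:C by case: e e0 => x y /=; rewrite ltcE /= => /andP[/eqP-> _].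
have e1 : 0 < Re e by move: e0; rewrite ee ltcR.
have e2 : 0 < Re e / 2 by rewrite divr_gt0.
move/cvgrPdist_lt: h1 => /(_ _ e2) h1; move/cvgrPdist_lt: h2 => /(_ _ e2) h2.
near=> n; rewrite ee normc_def ltcR -(sqr_sqrtr (ltW e1)).
have k1 : `|Re z - Re (u n)| < Re e / 2 by near: n.
have k2 : `|Im z - Im (u n)| < Re e / 2 by near: n.
rewrite sqr_sqrtr ?ltW // -[ltRHS]ger0_norm ?ltW // -sqrtr_sqr ltr_sqrt ?exprn_gt0 //.
rewrite !raddfB /=; move: k1 k2; rewrite !ltr_norml => /andP[? ?] /andP[? ?].
by nra.
Unshelve. all: by end_near. Qed.

Lemma cvg_Re u z : u @ \oo --> (z : R[i]^o) -> Re (u n) @[n --> \oo] --> Re z.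
Proof.
move=> uz; apply/cvgrPdist_lt => e e0.
have e1 : 0 < e%:C :> R[i] by rewrite ltcR.
move/cvgrPdist_lt: uz => /(_ _ e1) uz; near=> n.
rewrite -raddfB -ltcR; apply: le_lt_trans (normc_ge_Re _) _.
by near: n.
Unshelve. all: by end_near. Qed.

Lemma lim_complex u z : Re (u n) @[n --> \oo] --> Re z ->
  Im (u n) @[n --> \oo] --> Im z -> limn (u : nat -> R[i]^o) = z.
Proof. by move=> h1 h2; apply: cvg_lim; [exact: norm_hausdorff|exact: cvg_complex]. Qed.

End ComplexLimits.

Section RealInner.
Variable R : realType.
Implicit Types (x y z : cseq R) (c : R[i]).

(** The real part of the summand of [dot]. Real limits and inequalities then suffice, and the
    imaginary part is recovered in [dotE] by multiplying the first argument by ['i]. *)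
Definition cip x y : nat -> R := fun n => Re (x n) * Re (y n) + Im (x n) * Im (y n).
Definition ip x y : R := limn (series (cip x y)).

Lemma cipE x : (fun n => Normc.normc (x n) ^+ 2) = cip x x.
Proof. by apply/funext => n; rewrite normc_sqr /cip !expr2. Qed.

Lemma l2E x : l2 x = cvgn (series (cip x x)).
Proof. by rewrite /l2 /= cipE. Qed.

Lemma l2normE x : l2norm x = Num.sqrt (ip x x).
Proof. by rewrite /l2norm /ip cipE. Qed.

Lemma cip_ge0 x n : 0 <= cip x x n.
Proof. by rewrite addr_ge0 // -expr2 sqr_ge0. Qed.

Lemma ip_cvg x y : l2 x -> l2 y -> series (cip x y) @ \oo --> ip x y.
Proof.
rewrite !l2E => hx hy.
suff : cvgn (series (cip x y)) by [].
apply: (@normed_cvg _ R^o).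
apply: (@series_le_cvg _ _ (fun n => cip x x n + cip y y n)) => [n|n|n|] //=.
- by rewrite addr_ge0 ?cip_ge0.
- rewrite /cip; case: (x n) (y n) => [s t] [v w] /=; rewrite ler_norml.
  have := sqr_ge0 (s - v); have := sqr_ge0 (s + v).
  have := sqr_ge0 (t - w); have := sqr_ge0 (t + w).
  have := sqr_ge0 s; have := sqr_ge0 v; have := sqr_ge0 t; have := sqr_ge0 w.
  by move=> *; apply/andP; split; lra.
have -> : series (fun n => cip x x n + cip y y n) =
    (fun n => series (cip x x) n + series (cip y y) n).
  by apply/funext => n; rewrite /series /= big_split.
exact: is_cvgD.
Qed.

Lemma ip_lim x y (l : R) : series (cip x y) @ \oo --> l -> ip x y = l.
Proof. by move=> h; apply: cvg_lim. Qed.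

Lemma l2_le x (M : R) : (forall n, series (cip x x) n <= M) -> l2 x.
Proof.
move=> xM; rewrite l2E; apply: nondecreasing_is_cvgn.
  by apply: nondecreasing_series => n _ _; exact: cip_ge0.
by exists M => _ [n _ <-].
Qed.

Lemma ipC x y : ip x y = ip y x.
Proof.
by rewrite /ip; congr (limn (series _)); apply/funext => n; rewrite /cip; ring.
Qed.

Lemma l2D x y : l2 x -> l2 y -> l2 (x + y).
Proof.
move=> hx hy.
have := ip_cvg hx hx; have := ip_cvg hx hy; have := ip_cvg hy hy.
move=> h3 h2 h1; rewrite l2E.
have -> : series (cip (x + y) (x + y)) = (fun n => series (cip x x) n
    + 2 * series (cip x y) n + series (cip y y) n).
  apply/funext => n; rewrite /series /= mulr_sumr -!big_split /=.
  by apply: eq_bigr => i _; rewrite /cip !raddfD /=; ring.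
apply: is_cvgD; last by apply/cvg_ex; eexists; exact: h3.
apply: is_cvgD; first by apply/cvg_ex; eexists; exact: h1.
by apply/cvg_ex; eexists; apply: cvgM; [exact: cvg_cst|exact: h2].
Qed.

Lemma l2Z c x : l2 x -> l2 (c *: x).
Proof.
move=> hx; have h1 := ip_cvg hx hx; rewrite l2E.
have -> : series (cip (c *: x) (c *: x)) =
    (fun n => (Re c ^+ 2 + Im c ^+ 2) * series (cip x x) n).
  apply/funext => n; rewrite /series /= mulr_sumr.
  apply: eq_bigr => i _; rewrite /cip /= /GRing.scale /=.
  by case: c (x i) => p q [s t] /=; ring.
by apply/cvg_ex; eexists; apply: cvgM; [exact: cvg_cst|exact: h1].
Qed.

Lemma l20 : l2 (0 : cseq R).
Proof. by apply: (@l2_le _ 0) => n; rewrite /series /= big1 // => i _; rewrite /cip /= mulr0 addr0. Qed.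

Lemma l2B x y : l2 x -> l2 y -> l2 (x - y).
Proof. by move=> hx hy; rewrite -scaleN1r; apply: l2D => //; exact: l2Z. Qed.

Lemma ipDl x y z : l2 x -> l2 y -> l2 z -> ip (x + y) z = ip x z + ip y z.
Proof.
move=> hx hy hz; apply: ip_lim.
have -> : series (cip (x + y) z) = (fun n => series (cip x z) n + series (cip y z) n).
  apply/funext => n; rewrite /series /= -big_split /=.
  by apply: eq_bigr => i _; rewrite /cip !raddfD /=; ring.
by apply: cvgD; apply: ip_cvg.
Qed.

Lemma ipDr x y z : l2 x -> l2 y -> l2 z -> ip z (x + y) = ip z x + ip z y.
Proof. by move=> hx hy hz; rewrite ipC ipDl // !(ipC z). Qed.

Lemma ipZl c x y : l2 x -> l2 y ->
  ip (c *: x) y = Re c * ip x y + Im c * ip ('i *: x) y.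
Proof.
move=> hx hy; apply: ip_lim.
have -> : series (cip (c *: x) y) =
    (fun n => Re c * series (cip x y) n + Im c * series (cip ('i *: x) y) n).
  apply/funext => n; rewrite /series /= !mulr_sumr -big_split /=.
  apply: eq_bigr => k _; rewrite /cip /= /GRing.scale /=.
  by case: c (x k) (y k) => p q [s t] [v w] /=; ring.
by apply: cvgD; apply: cvgM; try exact: cvg_cst; apply: ip_cvg => //; exact: l2Z.
Qed.

Lemma ipiC x y : l2 x -> l2 y -> ip ('i *: x) y = - ip x ('i *: y).
Proof.
move=> hx hy; apply: ip_lim.
have -> : series (cip ('i *: x) y) = (fun n => - series (cip x ('i *: y)) n).
  apply/funext => n; rewrite /series /= -sumrN.
  apply: eq_bigr => k _; rewrite /cip /= /GRing.scale /=.
  by case: (x k) (y k) => [s t] [v w] /=; ring.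
by apply: cvgN; apply: ip_cvg => //; exact: l2Z.
Qed.

Lemma ipixx x : l2 x -> ip ('i *: x) x = 0.
Proof. by move=> hx; have := ipiC hx hx; rewrite (ipC x); lra. Qed.

Lemma ipRZl (t : R) x y : l2 x -> l2 y -> ip (t%:C *: x) y = t * ip x y.
Proof. by move=> hx hy; rewrite ipZl //= mul0r addr0. Qed.

Lemma ipRZr (t : R) x y : l2 x -> l2 y -> ip x (t%:C *: y) = t * ip x y.
Proof. by move=> hx hy; rewrite ipC ipRZl // ipC. Qed.

Lemma ipZr c x y : l2 x -> l2 y ->
  ip x (c *: y) = Re c * ip x y + Im c * ip x ('i *: y).
Proof. by move=> hx hy; rewrite ipC ipZl // !(ipC x). Qed.

Lemma ipii x y : l2 x -> l2 y -> ip ('i *: x) ('i *: y) = ip x y.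
Proof.
move=> hx hy; rewrite ipiC //; last exact: l2Z.
have -> : 'i *: ('i *: y) = (-1)%:C *: y.
  by rewrite scalerA; congr (_ *: _); rewrite -expr2 sqr_i rmorphN1.
by rewrite ipRZr //; ring.
Qed.

Lemma ipBl x y z : l2 x -> l2 y -> l2 z -> ip (x - y) z = ip x z - ip y z.
Proof.
move=> hx hy hz; rewrite -(scaleN1r y) -(rmorphN1 (real_complex R)).
by rewrite ipDl //; [rewrite ipRZl //; ring | exact: l2Z].
Qed.

Lemma ipBr x y z : l2 x -> l2 y -> l2 z -> ip z (x - y) = ip z x - ip z y.
Proof. by move=> hx hy hz; rewrite ipC ipBl // !(ipC z). Qed.

Lemma ip_sqrD x y : l2 x -> l2 y ->
  ip (x + y) (x + y) = ip x x + 2 * ip x y + ip y y.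
Proof.
move=> hx hy; rewrite ipDl //; last exact: l2D.
by rewrite !ipDr // (ipC y x); ring.
Qed.

Lemma ip_sqrB x y : l2 x -> l2 y ->
  ip (x - y) (x - y) = ip x x - 2 * ip x y + ip y y.
Proof.
move=> hx hy; rewrite ipBl //; last exact: l2B.
by rewrite !ipBr // (ipC y x); ring.
Qed.

Lemma series_cip_le x n : l2 x -> series (cip x x) n <= ip x x.
Proof.
move=> hx; apply: nondecreasing_cvgn_le; last by rewrite -l2E.
by apply: nondecreasing_series => k _ _; exact: cip_ge0.
Qed.

Lemma cip_le x n : l2 x -> cip x x n <= ip x x.
Proof.
move=> hx; apply: le_trans (series_cip_le n.+1 hx).
rewrite /series /= big_nat_recr //= lerDr sumr_ge0 // => i _; exact: cip_ge0.
Qed.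

Lemma ip_ge0 x : l2 x -> 0 <= ip x x.
Proof. by move=> hx; apply: le_trans (cip_le 0 hx); exact: cip_ge0. Qed.

Lemma ip_eq0 x : l2 x -> ip x x = 0 -> x = 0.
Proof.
move=> hx x0; apply/funext => n; have := cip_le n hx; rewrite x0 /cip.
case: (x n) => s t /= st.
by have [-> ->] : s = 0 /\ t = 0 by split; nra.
Qed.

Lemma ip_gt0 x : l2 x -> x <> 0 -> 0 < ip x x.
Proof. by move=> hx x0; rewrite lt_def ip_ge0 // andbT; apply/eqP => /(ip_eq0 hx). Qed.

Lemma dotE x y : l2 x -> l2 y -> dot x y = ip x y +i* ip ('i *: x) y.
Proof.
move=> hx hy; apply: lim_complex => /=.
  rewrite (_ : (fun n => _) = series (cip x y)); first exact: ip_cvg.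
  apply/funext => n; rewrite /series /= raddf_sum; apply: eq_bigr => k _.
  by rewrite /cip; case: (x k) (y k) => [s t] [v w] /=; ring.
rewrite (_ : (fun n => _) = series (cip ('i *: x) y)).
  by apply: ip_cvg => //; exact: l2Z.
apply/funext => n; rewrite /series /= raddf_sum; apply: eq_bigr => k _.
by rewrite /cip /GRing.scale /=; case: (x k) (y k) => [s t] [v w] /=; ring.
Qed.

(** The form is evaluated at its minimiser [- q / r]; if [r = 0] and [q] is nonzero, the chosen
    point gives the value -1. It serves both the inner product and the form of a positive
    operator. *)
Lemma discriminant_le (p q r : R) : 0 <= r ->
  (forall t, 0 <= p + t * (2 * q) + t ^+ 2 * r) -> q ^+ 2 <= p * r.
Proof.
rewrite le_eqVlt => /orP[/eqP <- h|r0 h].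
  have [->|q0] := eqVneq q 0; first by rewrite mulr0 expr0n.
  have := h (- (p + 1) / (2 * q)).
  by rewrite mulr0 addr0 divfK ?mulf_neq0 //; lra.
have := h (- q / r).
have -> : p + - q / r * (2 * q) + (- q / r) ^+ 2 * r = (p * r - q ^+ 2) / r.
  by field; rewrite gt_eqF.
by rewrite pmulr_lge0 ?invr_gt0 // subr_ge0.
Qed.

Lemma ip_CS x y : l2 x -> l2 y -> ip x y ^+ 2 <= ip x x * ip y y.
Proof.
move=> hx hy; apply: discriminant_le; first exact: ip_ge0.
move=> t; have hz := l2Z (c := t%:C) hy; have := ip_ge0 (l2D hx hz).
rewrite ipDl //; last exact: l2D.
rewrite !ipDr // !ipRZl // !ipRZr // (ipC y x) => h.
by apply: le_trans h _; rewrite le_eqVlt; apply/orP; left; apply/eqP; ring.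
Qed.

Lemma ip_CS_norm x y : l2 x -> l2 y -> `|ip x y| <= l2norm x * l2norm y.
Proof.
move=> hx hy; rewrite !l2normE -sqrtrM ?ip_ge0 // -sqrtr_sqr ler_sqrt.
  exact: ip_CS.
by rewrite mulr_ge0 ?ip_ge0.
Qed.

Lemma ip_basisr x k : ip x (basis_vec R k) = Re (x k).
Proof.
apply: ip_lim; apply: cvg_near_cst.
near=> n; rewrite /series /= (bigD1_seq k) ?iota_uniq //=.
  rewrite /cip /basis_vec eqxx /= mulr1 mulr0 addr0 big1 ?addr0 // => i /negbTE ->.
  by rewrite /= !mulr0 addr0.
by rewrite mem_index_iota /=; near: n; exists k.+1.
Unshelve. all: by end_near. Qed.

Lemma l2_finite x : finitely_supported x -> l2 x.
Proof.
move=> [N xN]; rewrite l2E; apply/cvg_ex; exists (series (cip x x) N).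
apply: cvg_near_cst.
near=> n; have Nn : (N <= n)%N by near: n; exists N.
rewrite /series /= (@big_cat_nat _ _ _ N) //= [X in _ + X]big_nat_cond [X in _ + X]big1 ?addr0 //.
by move=> i /andP[/andP[Ni _] _]; rewrite /cip xN //= mulr0 addr0.
Unshelve. all: by end_near. Qed.

Lemma basis_vec_finite k : finitely_supported (basis_vec R k).
Proof. by exists k.+1 => n kn; rewrite /basis_vec gtn_eqF. Qed.

Lemma l2_basis k : l2 (basis_vec R k).
Proof. exact/l2_finite/basis_vec_finite. Qed.

Arguments l2_basis : clear implicits.

Lemma ip_basisl x k : ip (basis_vec R k) x = Re (x k).
Proof. by rewrite ipC ip_basisr. Qed.

Lemma dot_basis x k : l2 x -> dot (basis_vec R k) x = x k.
Proof.
move=> hx; have hb := l2_basis k; rewrite dotE // ip_basisl ipiC // ip_basisl.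
by rewrite /GRing.scale /=; case: (x k) => s t /=; congr (_ +i* _); ring.
Qed.

End RealInner.
Arguments l2_basis : clear implicits.
Arguments l20 {R}.

(** * Positive operators *)

Section Operators.
Variable R : realType.
Implicit Types (x y z : cseq R) (C P T : cseq R -> cseq R).

Definition real_linear C := (forall x, l2 x -> l2 (C x)) /\
  (forall (t : R) x y, l2 x -> l2 y -> C (t%:C *: x + y) = t%:C *: C x + C y).

Definition ip_symmetric C := forall x y, l2 x -> l2 y -> ip x (C y) = ip y (C x).

Definition ip_positive C := forall x, l2 x -> 0 <= ip x (C x).

Definition ip_bounded (M : R) C :=
  forall x, l2 x -> ip (C x) (C x) <= M ^+ 2 * ip x x.

Lemma bounded_real_linear C : bounded_operator C -> real_linear C.
Proof. by case=> h1 h2 _; split => // t; apply: h2. Qed.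

Lemma bounded_ip_bounded C : bounded_operator C ->
  exists2 M, 0 < M & ip_bounded M C.
Proof.
case=> h1 _ [M hM]; exists (`|M| + 1); first by rewrite ltr_wpDl.
move=> x hx; have hCx := h1 _ hx; have := hM _ hx; rewrite !l2normE => h.
have s0 := sqrtr_ge0 (ip x x); have s1 := sqrtr_ge0 (ip (C x) (C x)).
have n0 := normr_ge0 M; have n1 := ler_norm M.
rewrite -[leLHS]sqr_sqrtr ?ip_ge0 // -[X in _ <= _ * X]sqr_sqrtr ?ip_ge0 //.
rewrite -exprMn ler_pXn2r ?nnegrE ?mulr_ge0 ?addr_ge0 //.
by apply: le_trans h _; apply: ler_wpM2r => //; lra.
Qed.

(* Cauchy-Schwarz for the form [ip x (C y)] at [y = C x]. *)
Lemma ip_sqr_le C M x : real_linear C -> ip_symmetric C -> ip_positive C ->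
  0 < M -> ip_bounded M C -> l2 x -> ip (C x) (C x) <= M * ip x (C x).
Proof.
move=> [Cl2 Clin] Csym Cpos M0 Cb hx; have hCx := Cl2 _ hx.
have hCCx := Cl2 _ hCx.
have form y : l2 y -> ip x (C y) ^+ 2 <= ip x (C x) * ip y (C y).
  move=> hy; have hCy := Cl2 _ hy; apply: discriminant_le; first exact: Cpos.
  move=> t; have htx := l2Z (c := t%:C) hy; have htCy := l2Z (c := t%:C) hCy.
  have := Cpos _ (l2D htx hx); rewrite Clin // !(ipDl, ipDr) //; try exact: l2D.
  rewrite !ipRZl // !ipRZr // (Csym y x) // => h.
  by apply: le_trans h _; rewrite le_eqVlt; apply/orP; left; apply/eqP; ring.
have h1 := form _ hCx; rewrite Csym // in h1.
have h2 := ip_CS hCx hCCx; have h3 := Cb _ hCx.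
have N0 := ip_ge0 hCx; have q0 := Cpos _ hx; have r0 := Cpos _ hCx.
move: N0; rewrite le_eqVlt => /orP[/eqP <-|N0].
  by rewrite mulr_ge0 // ltW.
set N := ip (C x) (C x) in h1 h2 h3 N0 *.
set q := ip x (C x) in h1 q0 *; set r := ip (C x) (C (C x)) in h1 h2 r0.
have h4 : r <= M * N.
  have MN := mulr_ge0 (ltW M0) (ltW N0).
  rewrite -(@ler_pXn2r _ 2) ?nnegrE //; apply: le_trans h2 _.
  by apply: le_trans (ler_wpM2l (ltW N0) h3) _; rewrite exprMn mulrCA -expr2.
rewrite -(ler_pM2r N0) -expr2; apply: le_trans h1 _.
by rewrite mulrAC [leRHS]mulrC; apply: ler_wpM2l.
Qed.

(** Polarisation: a form that is real on every vector is hermitian. At [- 'i *: x + y] the vanishing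
    imaginary part reads [ip x (C y) - ip y (C x) = 0]. *)
Lemma dot_ge0_symmetric C : bounded_operator C ->
  (forall x, l2 x -> 0 <= dot x (C x)) -> ip_symmetric C /\ ip_positive C.
Proof.
move=> [Cl2 Clin _] Cge.
have Cpos x : l2 x -> 0 <= ip x (C x) /\ ip ('i *: x) (C x) = 0.
  move=> hx; have := Cge _ hx; rewrite dotE //; last exact: Cl2.
  by rewrite lecE /= => /andP[/eqP -> ->].
split; last by move=> x /Cpos[].
have C0 : C 0 = 0.
  by have := Clin (-1) 0 0 (@l20 R) (@l20 R); rewrite scaler0 addr0 scaleN1r addNr.
move=> x y hx hy.
have hCx := Cl2 _ hx; have hCy := Cl2 _ hy.
have hx' := l2Z (c := - 'i) hx.
have Cx' : C (- 'i *: x) = - 'i *: C x.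
  have := Clin (- 'i) x 0 hx (@l20 R); rewrite C0 !addr0; exact.
have ix' : 'i *: (- 'i *: x) = x.
  by rewrite scalerA mulrN -expr2 sqr_i opprK scale1r.
have [_] := Cpos _ (l2D hx' hy).
have -> : C (- 'i *: x + y) = - 'i *: C x + C y.
  by rewrite (Clin (- 'i) x y).
have hiy := l2Z (c := 'i) hy; have hiCx := l2Z (c := - 'i) hCx.
rewrite scalerDr ix' ipDl //; last exact: l2D.
have e1 : ip x (- 'i *: C x) = 0.
  have [_] := Cpos _ hx'; by rewrite ix' Cx'.
have e2 : ip ('i *: y) (C y) = 0 by have [] := Cpos _ hy.
have e3 : ip ('i *: y) (- 'i *: C x) = - ip y (C x).
  by rewrite ipZr //= ipii //; ring.
by rewrite !ipDr // e1 e2 e3; lra.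
Qed.

(* If the form of [P - T + t] is nonnegative with [t > 0], then at a vector [x]
   where it is small, [(P + t) x] is close to [T x], which is impossible because
   [|T x| = |P x|] and [|(P + t) x|^2 >= |P x|^2 + t^2 |x|^2]. So [t] can be
   decreased, and the infimum of such [t] is [0]. *)
Lemma ip_le_of_norm_eq P T K : real_linear P -> real_linear T ->
  ip_symmetric P -> ip_symmetric T -> ip_positive P ->
  0 < K -> ip_bounded K P ->
  (forall x, l2 x -> ip (T x) (T x) = ip (P x) (P x)) ->
  forall x, l2 x -> ip x (T x) <= ip x (P x).
Proof.
move=> [Pl2 Plin] [Tl2 Tlin] Psym Tsym Ppos K0 PK TP.
pose S := [set t : R | 0 <= t /\ forall x, l2 x ->
  0 <= ip x (P x) - ip x (T x) + t * ip x x].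
have TK x : l2 x -> ip x (T x) <= K * ip x x.
  move=> hx; have := ip_CS hx (Tl2 _ hx); rewrite TP // => h.
  have n0 := ip_ge0 hx; have k1 := PK _ hx.
  case: (lerP (ip x (T x)) 0) => h0; first by apply: le_trans h0 _; rewrite mulr_ge0 // ltW.
  have Kn := mulr_ge0 (ltW K0) n0.
  rewrite -(@ler_pXn2r _ 2) ?nnegrE ?(ltW h0) //; apply: le_trans h _.
  by apply: le_trans (ler_wpM2l n0 k1) _; rewrite exprMn mulrCA -expr2.
have SK : S K.
  split; first exact: ltW.
  by move=> x hx; have := TK _ hx; have := Ppos _ hx; lra.
have Sinf : has_inf S by split; [exists K | exists 0 => t []].
have S0 : 0 <= inf S by apply: lb_le_inf; [exists K | move=> t []].
have Sinf_in : S (inf S).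
  split => // x hx; apply/ler_addgt0Pr => e e0.
  have n0 := ip_ge0 hx.
  have e1 : 0 < e / (ip x x + 1) by rewrite divr_gt0 // ltr_wpDl.
  have [t [_ ht] tlt] := inf_adherent e1 Sinf.
  apply: le_trans (ht _ hx) _.
  have : t * ip x x <= (inf S + e / (ip x x + 1)) * ip x x.
    by apply: ler_wpM2r => //; exact: ltW.
  have : e / (ip x x + 1) * ip x x <= e.
    rewrite mulrAC ler_pdivrMr ?ltr_wpDl //; nra.
  by lra.
move: S0; rewrite le_eqVlt => /orP[/eqP S0 x hx|t0].
  by have [_ /(_ _ hx)] := Sinf_in; rewrite -S0; lra.
exfalso; move: Sinf_in => []; set t := inf S in t0 * => _ St.
pose C x := P x - T x + t%:C *: x.
have Cl2 x : l2 x -> l2 (C x).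
  by move=> hx; apply: l2D; [apply: l2B; [exact: Pl2|exact: Tl2]|exact: l2Z].
have ipC_ z x : l2 z -> l2 x -> ip z (C x) = ip z (P x) - ip z (T x) + t * ip z x.
  move=> hz hx; have h1 := Pl2 _ hx; have h2 := Tl2 _ hx.
  rewrite ipDr //; [|exact: l2B|exact: l2Z].
  by rewrite ipBr // ipRZr.
have Clin : real_linear C.
  split => // s x y hx hy; rewrite /C Plin // Tlin //.
  rewrite !scalerDr scalerN !scalerA [_ * s%:C]mulrC opprD.
  move: (s%:C *: P x) (s%:C *: T x) (_ *: x) (_ *: y) => q1 q2 q3 q4.
  by rewrite !addrA; apply/funext => n; rewrite !fctE; ring.
have Csym : ip_symmetric C.
  by move=> x y hx hy; rewrite !ipC_ // Psym // Tsym // (ipC x).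
have Cpos : ip_positive C by move=> x hx; rewrite ipC_ //; exact: St.
(* The squared norms [j1], [j2], [j3] below give [|C x|^2 <= 3 (|P x|^2 + |T x|^2 + t^2 |x|^2)],
   which is at most [M^2 |x|^2]. *)
pose M := 3 * (K + t).
have M0 : 0 < M by rewrite mulr_gt0 ?addr_gt0.
have CM : ip_bounded M C.
  move=> x hx; have h1 := Pl2 _ hx; have h2 := Tl2 _ hx; have hC := Cl2 _ hx.
  have n0 := ip_ge0 hx; have k1 := PK _ hx; have k2 := TP _ hx.
  have j1 := ip_ge0 (l2D h1 h2).
  have hx' := l2Z (c := t%:C) hx.
  have j2 := ip_ge0 (l2B h1 hx'); have j3 := ip_ge0 (l2D h2 hx').
  rewrite ip_sqrD // in j1; rewrite ip_sqrB // ipRZl // !ipRZr // (ipC (P x) x) in j2.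
  rewrite ip_sqrD // ipRZl // !ipRZr // (ipC (T x) x) in j3; move: j1 j2 j3.
  rewrite ipC_ // [ip (C x) (P x)]ipC [ip (C x) (T x)]ipC [ip (C x) x]ipC !ipC_ //.
  rewrite (ipC (T x) (P x)) (ipC (P x) x) (ipC (T x) x) k2.
  set p := ip (P x) (P x) in k1 *; set n := ip x x in n0 k1 *.
  move: (ip (P x) (T x)) (ip x (P x)) (ip x (T x)) => A B D j1 j2 j3.
  have k3 : 0 <= K * t by rewrite mulr_ge0 // ltW.
  have : 0 <= (K * t) * n by rewrite mulr_ge0.
  have : 0 <= t ^+ 2 * n by rewrite mulr_ge0 // sqr_ge0.
  have : 0 <= K ^+ 2 * n by rewrite mulr_ge0 // sqr_ge0.
  rewrite /M; nra.
(* Expanding [|P x + t x|^2 = |T x + C x|^2] gives [t^2 |x|^2 <= 2 ip (T x) (C x) + |C x|^2]. The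
   weight [s] is such that Young's inequality, which bounds the cross term by
   [s |P x|^2 + |C x|^2 / s], costs only half of the left side; [d] collects what remains after
   [|C x|^2 <= M ip x (C x)]. *)
pose s := t ^+ 2 / (2 * K ^+ 2).
have s0 : 0 < s by rewrite divr_gt0 ?exprn_gt0 // mulr_gt0 ?exprn_gt0.
pose d := (t ^+ 2 / 2) / ((1 + s^-1) * M).
have d0 : 0 < d.
  by rewrite !divr_gt0 ?exprn_gt0 // mulr_gt0 // addr_gt0 ?invr_gt0.
have Cd x : l2 x -> d * ip x x <= ip x (C x).
  move=> hx; have h1 := Pl2 _ hx; have h2 := Tl2 _ hx; have hC := Cl2 _ hx.
  have hx' := l2Z (c := t%:C) hx.
  have n0 := ip_ge0 hx; have k1 := PK _ hx; have k2 := TP _ hx.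
  have hc := ip_sqr_le Clin Csym Cpos M0 CM hx.
  rewrite mulrAC ler_pdivrMr ?mulr_gt0 ?addr_gt0 ?invr_gt0 //.
  have e : P x + t%:C *: x = T x + C x.
    by rewrite /C [P x - T x]addrC addrA addNKr.
  have := ip_sqrD h1 hx'; rewrite e ip_sqrD // ipRZl // !ipRZr // (ipC (P x) x) k2 => j1.
  have hT' := l2Z (c := s%:C) h2.
  have := ip_ge0 (l2B hT' hC); rewrite ip_sqrB // !ipRZl // !ipRZr // k2 => j2.
  have p0 := Ppos _ hx.
  have j3 : 2 * ip (T x) (C x) <= s * ip (P x) (P x) + s^-1 * ip (C x) (C x).
    rewrite -(ler_pM2l s0) mulrDr mulVKf ?gt_eqF //; lra.
  have j4 : s * ip (P x) (P x) <= t ^+ 2 / 2 * ip x x.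
    apply: le_trans (ler_wpM2l (ltW s0) k1) _.
    rewrite le_eqVlt; apply/orP; left; apply/eqP; rewrite /s.
    by field; rewrite gt_eqF.
  have j5 : t ^+ 2 / 2 * ip x x <= (1 + s^-1) * ip (C x) (C x) by nra.
  apply: le_trans j5 _; rewrite [leRHS]mulrC -mulrA.
  by apply: ler_wpM2l => //; rewrite addr_ge0 // invr_ge0 ltW.
have : S (Num.max 0 (t - d)).
  split; first by rewrite le_max lexx.
  move=> x hx; have := Cd _ hx; rewrite ipC_ // => h.
  have n0 := ip_ge0 hx.
  have : (t - d) * ip x x <= Num.max 0 (t - d) * ip x x.
    by apply: ler_wpM2r => //; rewrite le_max lexx orbT.
  by lra.
move/(ge_inf (proj2 Sinf)); rewrite -/t le_max leNgt t0 /=; lra.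
Qed.

End Operators.

(** * Jacobi operators *)

Section JacobiClosure.
Variable R : realType.
Implicit Types (a b : nat -> R) (x y d u : cseq R) (f g : nat -> R).


(** The matrix is real, so it acts separately on real and imaginary parts. *)
Definition ract a b f : nat -> R :=
  fun n => (if n is n'.+1 then a n' * f n' else 0) + b n * f n + a n * f n.+1.

Lemma Re_realM (t : R) (z : R[i]) : Re (t%:C * z) = t * Re z.
Proof. by case: z => p q /=; ring. Qed.

Lemma Im_realM (t : R) (z : R[i]) : Im (t%:C * z) = t * Im z.
Proof. by case: z => p q /=; ring. Qed.

Lemma ReD (z w : R[i]) : Re (z + w) = Re z + Re w.
Proof. by case: z w => [? ?] []. Qed.

Lemma ImD (z w : R[i]) : Im (z + w) = Im z + Im w.
Proof. by case: z w => [? ?] []. Qed.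

Lemma Re_act a b x n : Re (act a b x n) = ract a b (fun k => Re (x k)) n.
Proof. by rewrite /act /ract; case: n => [|n]; rewrite !ReD !Re_realM. Qed.

Lemma Im_act a b x n : Im (act a b x n) = ract a b (fun k => Im (x k)) n.
Proof. by rewrite /act /ract; case: n => [|n]; rewrite !ImD !Im_realM. Qed.

Lemma actD a b x y : act a b (x + y) = act a b x + act a b y.
Proof. by apply/funext => -[|n]; rewrite /act !fctE; ring. Qed.

Lemma actZ a b (c : R[i]) x : act a b (c *: x) = c *: act a b x.
Proof. by apply/funext => -[|n]; rewrite /act !fctE /GRing.scale /=; ring. Qed.

Lemma actB a b x y : act a b (x - y) = act a b x - act a b y.
Proof. by rewrite actD -[- y]scaleN1r actZ scaleN1r. Qed.

Lemma act_finite a b u : finitely_supported u -> finitely_supported (act a b u).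
Proof.
move=> [N uN]; exists N.+1 => -[//|n] Nn; rewrite /act !uN ?mulr0 ?addr0 //; lia.
Qed.

Lemma ip_finite x y N : (forall n, (N <= n)%N -> cip x y n = 0) ->
  ip x y = series (cip x y) N.
Proof.
move=> h; apply: ip_lim; apply: cvg_near_cst; near=> n.
have Nn : (N <= n)%N by near: n; exists N.
rewrite /series /= (@big_cat_nat _ _ _ N) //= [X in _ + X]big_nat_cond.
by rewrite [X in _ + X]big1 ?addr0 // => i /andP[/andP[Ni _] _]; exact: h.
Unshelve. all: by end_near. Qed.

Lemma act_green a b u d : finitely_supported u ->
  ip (act a b u) d = ip u (act a b d).
Proof.
move=> fu; have [N uN] := fu.
(* The boundary term of summation by parts; it vanishes once [n] has passed the support of [u]. *)
pose bd f g n : R := if n is n'.+1 then a n' * (f n * g n' - f n' * g n) else 0.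
have green f g n : \sum_(0 <= k < n) ract a b f k * g k =
    \sum_(0 <= k < n) f k * ract a b g k + bd f g n.
  elim: n => [|n IH]; first by rewrite !big_nil addr0.
  by rewrite !big_nat_recr //= IH /ract; case: n {IH} => [|n] /=; ring.
rewrite (@ip_finite _ _ N.+1); last first.
  move=> [|n] Nn //; rewrite /cip Re_act Im_act /ract.
  have un k : u (n + k)%N = 0 by apply: uN; lia.
  have := un 0; have := un 1; have := un 2; rewrite addn0 addn1 addn2 => -> -> ->.
  by rewrite /= !(mulr0, mul0r, addr0).
rewrite (@ip_finite _ _ N.+1); last first.
  by move=> n Nn; rewrite /cip (uN _ (ltnW Nn)) /= !mul0r addr0.
have -> : series (cip (act a b u) d) N.+1 =
    \sum_(0 <= k < N.+1) ract a b (fun k => Re (u k)) k * Re (d k)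
    + \sum_(0 <= k < N.+1) ract a b (fun k => Im (u k)) k * Im (d k).
  by rewrite -big_split; apply: eq_bigr => k _; rewrite /cip Re_act Im_act.
have -> : series (cip u (act a b d)) N.+1 =
    \sum_(0 <= k < N.+1) Re (u k) * ract a b (fun k => Re (d k)) k
    + \sum_(0 <= k < N.+1) Im (u k) * ract a b (fun k => Im (d k)) k.
  by rewrite -big_split; apply: eq_bigr => k _; rewrite /cip Re_act Im_act.
by rewrite !green /bd (uN N) // (uN N.+1) //= !mul0r subr0 mulr0 !addr0.
Qed.

Lemma ip_cvgl x d (xs : nat -> cseq R) :
  (forall i, l2 (xs i)) -> l2 x -> l2 d ->
  l2norm (xs i - x) @[i --> \oo] --> (0 : R) ->
  ip (xs i) d @[i --> \oo] --> ip x d.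
Proof.
move=> hxs hx hd h.
apply/subr_cvg0; apply/norm_cvg0P.
have h' : l2norm (xs i - x) * l2norm d @[i --> \oo] --> (0 : R).
  by rewrite -(mul0r (l2norm d)); apply: cvgM => //; exact: cvg_cst.
apply: squeeze_cvgr (@cvg_cst _ _ _ _ _) h'; near=> i.
by rewrite normr_ge0 -ipBl //=; apply: ip_CS_norm => //; exact: l2B.
Unshelve. all: by end_near. Qed.

(** Green's formula survives the closure because both sides are continuous in l2: the matrix action
    on its largest domain is contained in the adjoint of the Jacobi operator. *)
Lemma jacobi_adjoint a b x y d : jacobi a b x y -> l2 d -> l2 (act a b d) ->
  ip y d = ip x (act a b d).
Proof.
move=> [hx hy [u [fu ux uy]]] hd had.
have lu i : l2 (u i) := l2_finite (fu i).
have lau i : l2 (act a b (u i)) := l2_finite (act_finite a b (fu i)).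
have h1 := ip_cvgl lau hy hd uy; have h2 := ip_cvgl lu hx had ux.
have e : (fun i => ip (act a b (u i)) d) = (fun i => ip (u i) (act a b d)).
  by apply/funext => i; exact: act_green.
by rewrite e in h1; rewrite -(cvg_lim (@Rhausdorff R) h1) -(cvg_lim (@Rhausdorff R) h2).
Qed.

Lemma ip_ibasisr x k : ip x ('i *: basis_vec R k) = Im (x k).
Proof.
rewrite (@ip_finite _ _ k.+1); last first.
  by move=> n kn; rewrite /cip /basis_vec /GRing.scale /= gtn_eqF //=; ring.
rewrite /series /= big_nat_recr //= big_nat_cond big1 ?add0r.
  by rewrite /cip /basis_vec /GRing.scale /= eqxx /=; ring.
move=> i /andP[/andP[_ ik] _].
by rewrite /cip /basis_vec /GRing.scale /= ltn_eqF //=; ring.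
Qed.

(** Testing against [basis_vec R k] and against its multiple by ['i] reads off the real and the
    imaginary part of coordinate [k]. *)
Lemma jacobi_act a b x y : jacobi a b x y -> y = act a b x.
Proof.
move=> A; apply/funext => k.
have fb := basis_vec_finite R k.
have fib : finitely_supported ('i *: basis_vec R k).
  by have [N bN] := fb; exists N => n Nn; rewrite fctE bN // scaler0.
have h1 := jacobi_adjoint A (l2_finite fb) (l2_finite (act_finite a b fb)).
have h2 := jacobi_adjoint A (l2_finite fib) (l2_finite (act_finite a b fib)).
rewrite (ipC x) act_green // [RHS]ipC !ip_basisr in h1.
rewrite (ipC x) act_green // [RHS]ipC !ip_ibasisr in h2.
by move: h1 h2; case: (y k) (act a b x k) => ? ? [? ?] /= -> ->.
Qed.

Lemma jacobi_finite a b u : finitely_supported u -> jacobi a b u (act a b u).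
Proof.
move=> fu; have fau := act_finite a b fu.
have n0 : l2norm (0 : cseq R) = 0.
  rewrite l2normE (@ip_finite _ _ 0) /series /= ?big_nil ?sqrtr0 // => n _.
  by rewrite /cip /= !mul0r addr0.
split; [exact: l2_finite | exact: l2_finite |].
by exists (fun=> u); split => //; rewrite subrr n0; exact: cvg_cst.
Qed.

(** The closure from finitely supported sequences is already the maximal operator (the limit point
    case). This is what puts a sequence known only through its recurrence and its summability into
    the domain. *)
Definition maximal_domain a b := forall x, l2 x -> l2 (act a b x) ->
  jacobi a b x (act a b x).

(** The difference of [x] and [T (act a b x)] is annihilated by the matrix, hence orthogonal to the
    range of the Jacobi operator, which is all of l2. *)
Lemma inverse_maximal_domain a b T : is_inverse (jacobi a b) T ->
  maximal_domain a b.
Proof.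
move=> [TA _] x hx hax; have A := TA _ hax; have e := jacobi_act A.
have [hT _ _] := A.
have hd : l2 (x - T (act a b x)) by exact: l2B.
have ad : act a b (x - T (act a b x)) = 0 by rewrite actB -e subrr.
suff d0 : x - T (act a b x) = 0 by rewrite {1}(subr0_eq d0).
have orth d : l2 d -> act a b d = 0 -> forall k, Re (d k) = 0.
  move=> ld ad0 k; have Ak := TA _ (l2_basis R k).
  have := jacobi_adjoint Ak ld; rewrite ad0 => /(_ (@l20 R)).
  rewrite ip_basisl => ->; rewrite (@ip_finite _ _ 0) /series /= ?big_nil //.
  by move=> n _; rewrite /cip /= !mulr0 addr0.
apply/funext => k; have h1 := orth _ hd ad k.
(* [orth] sees only real parts; at ['i] times the vector it yields the imaginary ones. *)
have := orth ('i *: (x - T (act a b x))) (l2Z hd).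
rewrite actZ ad scaler0 => /(_ erefl k); move: h1.
rewrite [('i *: _) k]/GRing.scale /= /GRing.scale /=.
by case: ((x - T (act a b x)) k) => s t /= -> ; rewrite mul0r mul1r sub0r => /eqP; rewrite oppr_eq0 => /eqP ->.
Qed.

Lemma l2norm_triangle x y : l2 x -> l2 y -> l2norm (x + y) <= l2norm x + l2norm y.
Proof.
move=> hx hy; rewrite !l2normE.
rewrite -(@ler_pXn2r _ 2) ?nnegrE ?addr_ge0 ?sqrtr_ge0 //.
rewrite sqr_sqrtr ?ip_ge0 //; last exact: l2D.
rewrite ip_sqrD // sqrrD !sqr_sqrtr ?ip_ge0 //.
have := ip_CS_norm hx hy; rewrite !l2normE => h.
have := le_trans (ler_norm _) h; rewrite mulr2n; lra.
Qed.

Definition tl x : cseq R := fun n => x n.+1.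

Lemma series_cip_tl x y n :
  series (cip x y) n.+1 = cip x y 0 + series (cip (tl x) (tl y)) n.
Proof. by rewrite /series /= big_nat_recl. Qed.

Lemma l2_tl x : l2 x <-> l2 (tl x).
Proof.
split=> hx.
  apply: (@l2_le _ _ (ip x x)) => n; apply: le_trans (series_cip_le n.+1 hx).
  by rewrite series_cip_tl lerDr cip_ge0.
apply: (@l2_le _ _ (cip x x 0 + ip (tl x) (tl x))) => -[|n].
  by rewrite /series /= big_nil addr_ge0 ?cip_ge0 ?ip_ge0.
by rewrite series_cip_tl lerD2l series_cip_le.
Qed.

Lemma l2norm_tl x : l2 x -> l2norm (tl x) <= l2norm x.
Proof.
move=> hx; rewrite !l2normE ler_sqrt ?ip_ge0 //.
have ht := (l2_tl x).1 hx; apply: limr_le; first by apply/cvg_ex; eexists; exact: ip_cvg.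
near=> n; apply: le_trans (series_cip_le n.+1 hx).
by rewrite series_cip_tl lerDr cip_ge0.
Unshelve. all: by end_near. Qed.

Lemma norm_coord_le x n : l2 x -> Normc.normc (x n) <= l2norm x.
Proof.
move=> hx; rewrite l2normE -(@ler_pXn2r _ 2) ?nnegrE ?sqrtr_ge0 //; last first.
  by case: (x n) => s t /=; exact: sqrtr_ge0.
by rewrite sqr_sqrtr ?ip_ge0 // normc_sqr !expr2; exact: cip_le.
Qed.

Lemma l2norm_Zbasis (c : R[i]) k : l2norm (c *: basis_vec R k) = Normc.normc c.
Proof.
rewrite l2normE (@ip_finite _ _ k.+1); last first.
  by move=> n kn; rewrite /cip /basis_vec /GRing.scale /= gtn_eqF //=; case: c => s t /=; ring.
rewrite /series /= big_nat_recr //= big_nat_cond big1 ?add0r; last first.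
  move=> i /andP[/andP[_ ik] _].
  by rewrite /cip /basis_vec /GRing.scale /= ltn_eqF //=; case: c => s t /=; ring.
rewrite /cip /basis_vec /GRing.scale /= eqxx.
by case: c => s t /=; congr Num.sqrt; ring.
Qed.

(** The sequence is prefixed by 0, approximated in the larger space, and the approximants are cut
    again. Cutting creates the error [a 0 * u i 0] in row 0, which tends to 0 because the prefixed
    entry is 0. *)
Lemma maximal_domain_shift a b : maximal_domain a b ->
  maximal_domain (fun n => a n.+1) (fun n => b n.+1).
Proof.
move=> SA x hx hax.
pose x' : cseq R := fun n => if n is n'.+1 then x n' else 0.
have tlact u : act (fun n => a n.+1) (fun n => b n.+1) (tl u) =
    tl (act a b u) - ((a 0)%:C * u 0%N) *: basis_vec R 0.
  apply/funext => -[|n]; rewrite /act /tl /basis_vec !fctE /GRing.scale /=; ring.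
have hx' : l2 x' by apply/l2_tl.
have etl : tl (act a b x') = act (fun n => a n.+1) (fun n => b n.+1) x.
  by rewrite (tlact x') /= mulr0 scale0r subr0.
have hax' : l2 (act a b x') by apply/l2_tl; rewrite etl.
have [_ _ [u [fu ux uy]]] := SA _ hx' hax'.
have lu i : l2 (u i) := l2_finite (fu i).
have lau i : l2 (act a b (u i)) := l2_finite (act_finite a b (fu i)).
split => //; exists (fun i => tl (u i)); split.
- by move=> i; have [N uN] := fu i; exists N => n Nn; apply: uN; exact: leqW.
- apply: squeeze_cvgr (@cvg_cst _ _ _ _ _) ux; near=> i.
  rewrite {1}l2normE sqrtr_ge0 /=.
  by have := l2norm_tl (l2B (lu i) hx').
have h : l2norm (act a b (u i) - act a b x') + `|a 0| * l2norm (u i - x')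
    @[i --> \oo] --> (0 : R).
  rewrite -[X in _ --> X]addr0 -[X in _ --> _ + X](mulr0 `|a 0|).
  by apply: cvgD => //; apply: cvgM => //; exact: cvg_cst.
apply: squeeze_cvgr (@cvg_cst _ _ _ _ _) h; near=> i.
rewrite {1}l2normE sqrtr_ge0 /= tlact -etl.
set c := (a 0)%:C * u i 0.
have -> : tl (act a b (u i)) - c *: basis_vec R 0 - tl (act a b x') =
    tl (act a b (u i) - act a b x') + (- c) *: basis_vec R 0.
  by rewrite scaleNr addrAC.
have hd := l2B (lau i) hax'.
apply: le_trans (l2norm_triangle ((l2_tl _).1 hd) (l2Z (l2_basis R 0))) _.
apply: lerD; first exact: l2norm_tl.
rewrite l2norm_Zbasis normcN Normc.normcM; apply: ler_pM.
- by rewrite /=; exact: sqrtr_ge0.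
- by case: (u i 0) => s t /=; exact: sqrtr_ge0.
- by rewrite /= expr0n /= addr0 sqrtr_sqr.
by have := norm_coord_le 0 (l2B (lu i) hx'); rewrite !fctE subr0.
Unshelve. all: by end_near. Qed.

End JacobiClosure.

(** * Consequences of trace class for finite sections *)

Section FiniteBounds.
Variables (R : realType) (a b : nat -> R).

Definition cplx (g : nat -> R) : cseq R := fun n => (g n)%:C.

Definition finite_support (g : nat -> R) := exists N, forall n, (N <= n)%N -> g n = 0.

(** Here [M] bounds the inverse and [t k] is its diagonal entry. The equations are imposed only
    where [g] is nonzero: a solution for a finite section, extended by zero, violates them just
    outside its block, where the pairing with [g] does not notice. *)
Record finite_bounds (M : R) (t : nat -> R) : Prop := FiniteBounds {
  fb_M : 0 < M;
  fb_t : forall n, 0 <= t n;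
  fb_sum : cvgn (series t);
  fb_eigen : forall g x, finite_support g ->
    (forall j, g j != 0 -> ract a b g j = x * g j) -> (exists j, g j != 0) -> 0 < x;
  fb_green : forall g K, finite_support g ->
    (forall j, g j != 0 -> ract a b g j = (j == K)%:R) -> g K <= t K;
  fb_green_l2 : forall g K, finite_support g ->
    (forall j, g j != 0 -> ract a b g j = (j == K)%:R) ->
    forall N, \sum_(0 <= j < N) g j ^+ 2 <= M * g K }.

Lemma ip_cplxl g x : ip (cplx g) x = limn (series (fun n => g n * Re (x n))).
Proof.
by congr (limn (series _)); apply/funext => n; rewrite /cip /= mul0r addr0.
Qed.

Lemma act_cplx g : act a b (cplx g) = cplx (ract a b g).
Proof.
apply/funext => n; rewrite /act /cplx /ract !rmorphD !rmorphM.
by case: n => [|n]; rewrite ?rmorphM ?rmorph0.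
Qed.

Lemma ip_cplx_act g (f : nat -> R) : (forall j, g j != 0 -> ract a b g j = f j) ->
  ip (cplx g) (act a b (cplx g)) = ip (cplx g) (cplx f).
Proof.
move=> gf; rewrite !ip_cplxl; congr (limn (series _)); apply/funext => n.
rewrite act_cplx /=; have [->|g0] := eqVneq (g n) 0; first by rewrite !mul0r.
by rewrite gf.
Qed.

Lemma cplx_basis K : cplx (fun j => (j == K)%:R) = basis_vec R K.
Proof. by apply/funext => n; rewrite /cplx /basis_vec rmorph_nat. Qed.

(** The symmetry of [T] comes from [jacobi_adjoint] and its positivity from that of the operator;
    the sum of [t] converges by comparison with the diagonal of [P]. *)
Lemma trace_class_finite_bounds : positive_definite (jacobi a b) ->
  inverse_trace_class (jacobi a b) -> exists M t, finite_bounds M t.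
Proof.
move=> posdef [T [[TA AT] [Tb [P [[Pb Ppos PT] Ptr]]]]].
have Tlin := bounded_real_linear Tb; have Plin := bounded_real_linear Pb.
have [Tl2 Tlin2] := Tlin.
have Tact y : l2 y -> act a b (T y) = y by move=> /TA /jacobi_act.
have Tsym : ip_symmetric T.
  move=> x y hx hy; have hTy := Tl2 _ hy.
  have had : l2 (act a b (T y)) by rewrite Tact.
  by rewrite (jacobi_adjoint (TA _ hx) hTy had) Tact // ipC.
have Tpos : ip_positive T.
  move=> y hy; have [T0|T0] := pselect (T y = 0).
    rewrite T0 ipC (@ip_finite _ _ _ 0) /series /= ?big_nil // => n _.
    by rewrite /cip /= !mul0r addr0.
  have hTy := Tl2 _ hy; have := posdef _ _ (TA _ hy) T0.
  by rewrite dotE // ltcE /= (ipC y) => /andP[_ /ltW].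
have [M M0 TM] := bounded_ip_bounded Tb.
have [K K0 PK] := bounded_ip_bounded Pb.
have [Psym Ppos'] := dot_ge0_symmetric Pb Ppos.
have TP x : l2 x -> ip (T x) (T x) = ip (P x) (P x).
  move=> hx; have := PT _ _ hx hx; have hTx := Tl2 _ hx.
  have hPx : l2 (P x) by case: Plin => h _; exact: h.
  by rewrite !dotE // => -[-> _].
have T_le_P := ip_le_of_norm_eq Plin Tlin Psym Tsym Ppos' K0 PK TP.
(* This is [ip_sqr_le] for [T] at the vector [y], where [T y = x]. *)
have coerc x y : jacobi a b x y -> ip x x <= M * ip x y.
  move=> A; have [hx hy _] := A; have := ip_sqr_le Tlin Tsym Tpos M0 TM hy.
  by rewrite (AT _ _ A) (ipC y).
pose t k := Re (T (basis_vec R k) k).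
have tE k : t k = ip (basis_vec R k) (T (basis_vec R k)) by rewrite ip_basisl.
have hb := l2_basis R.
have t0 k : 0 <= t k by rewrite tE; exact: Tpos.
have fin g : finite_support g -> finitely_supported (cplx g).
  by move=> [N gN]; exists N => n Nn; rewrite /cplx gN.
have l2g g : finite_support g -> l2 (cplx g) by move=> /fin /l2_finite.
have Jg g : finite_support g -> jacobi a b (cplx g) (act a b (cplx g)).
  by move=> /fin /jacobi_finite.
have green g k : finite_support g ->
    (forall j, g j != 0 -> ract a b g j = (j == k)%:R) ->
    ip (cplx g) (act a b (cplx g)) = g k.
  by move=> fg /ip_cplx_act ->; rewrite cplx_basis ip_basisr.
exists M, t; split => //.
- apply: (@series_le_cvg _ t (fun k => Re (P (basis_vec R k) k))) => // [k|k|].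
  + by rewrite -ip_basisl; exact: Ppos'.
  + by rewrite tE -ip_basisl; exact: T_le_P.
  move/cvg_ex: Ptr => [l hl]; apply/cvg_ex; exists (Re l).
  suff -> : series (fun k => Re (P (basis_vec R k) k)) = (fun n => Re (series
      (fun n => dot (basis_vec R n) (P (basis_vec R n)) : R[i]^o) n)) by exact: cvg_Re.
  apply/funext => n; rewrite /series /= raddf_sum; apply: eq_bigr => k _.
  by rewrite dot_basis //; case: Plin => h _; exact: h.
- move=> g x fg gx [j gj].
  have hg := l2g _ fg; have hxg := l2Z (c := x%:C) hg.
  have e : ip (cplx g) (act a b (cplx g)) = x * ip (cplx g) (cplx g).
    rewrite (ip_cplx_act gx) -ipRZr //; congr ip; apply/funext => n.
    by rewrite /cplx rmorphM.
  have := coerc _ _ (Jg _ fg); rewrite e mulrA => h.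
  have gp : 0 < ip (cplx g) (cplx g).
    apply: ip_gt0 => // /(congr1 (fun f => f j)) /(congr1 (@complex.Re _)) /= g0.
    by rewrite g0 eqxx in gj.
  by move: h; rewrite -[leLHS]mul1r ler_pM2r // => h; nra.
(* With [J] the matrix action and [r = e_k - J g], positivity of [T] at [r] gives the claim:
   [ip r (T r) = t k - 2 g k + ip (J g) g], and the last term is [g k]. *)
- move=> g k fg gk; have hg := l2g _ fg; have [_ hag _] := Jg _ fg.
  have hT := Tl2 _ (hb k).
  have e : T (basis_vec R k - act a b (cplx g)) = T (basis_vec R k) - cplx g.
    rewrite addrC -scaleN1r -(rmorphN1 (real_complex R)) Tlin2 // (AT _ _ (Jg _ fg)).
    by rewrite rmorphN1 scaleN1r addrC.
  have := Tpos _ (l2B (hb k) hag); rewrite e ipBl //; last exact: l2B.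
  rewrite !ipBr // -tE ip_basisl /= act_green; last exact: fin.
  rewrite Tact // ip_basisr /= (ipC (act _ _ _)) (green _ _ fg gk); lra.
- move=> g k fg gk N; have hg := l2g _ fg.
  rewrite -(green _ _ fg gk); apply: le_trans (coerc _ _ (Jg _ fg)).
  apply: le_trans (series_cip_le N hg); rewrite /series /=; apply: ler_sum => i _.
  by rewrite /cip /= mulr0 addr0 expr2.
Qed.

End FiniteBounds.

(** * Inverses of finite sections *)

Section GreenVectors.
Variables (R : realType) (a b : nat -> R).
Hypothesis a_gt0 : forall n, 0 < a n.
Local Notation cont := (cont a b).

Definition pad m n (f : nat -> R) : nat -> R :=
  fun k => if (m <= k < m + n)%N then f (k - m)%N else 0.

Lemma padE m n f j : pad m n f (m + j) = if (j < n)%N then f j else 0.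
Proof. by rewrite /pad leq_addr ltn_add2l addKn. Qed.

Lemma pad_neq0 m n f k : pad m n f k != 0 -> exists2 j, k = (m + j)%N & (j < n)%N.
Proof.
rewrite /pad; case: ifP => [/andP[mk kn] _|]; last by rewrite eqxx.
by exists (k - m)%N; lia.
Qed.

Lemma finite_pad m n f : finite_support (pad m n f).
Proof. by exists (m + n)%N => k kn; rewrite /pad [(k < _)%N]ltnNge kn andbF. Qed.

(** The condition [f n = 0] hides the cut at the right end; at the left end the padding supplies the
    0 that the shifted matrix has there. *)
Lemma ract_pad m n f j : f n = 0 -> (j < n)%N -> ract a b (pad m n f) (m + j) =
  ract (fun k => a (m + k)%N) (fun k => b (m + k)%N) f j.
Proof.
move=> fn jn; rewrite /ract -addnS !padE jn.
have -> : (if (j.+1 < n)%N then f j.+1 else 0) = f j.+1.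
  by case: ltnP => // nj; have -> : j.+1 = n by lia.
congr (_ + _ + _); case: j jn => [|j] jn; last by rewrite addnS padE ltnW.
rewrite addn0; case: m => [|m] //.
by rewrite /pad ltnn /= mulr0.
Qed.

Definition prod_a m j : R := \prod_(i < j) a (m + i)%N.

Lemma prod_a_neq0 m j : prod_a m j != 0.
Proof. by apply/prodf_neq0 => i _; rewrite gt_eqF. Qed.

Lemma prod_aS m j : prod_a m j.+1 = prod_a m j * a (m + j)%N.
Proof. by rewrite /prod_a big_ord_recr. Qed.

(* Solutions of the three-term recurrence of the matrix without its first [m]
   rows and columns: [left_sol] satisfies the first row, and [right_sol], at
   [x = 0], vanishes at index [n]. *)
Definition left_sol m x j : R := (-1) ^+ j * (cont m j.+1).[x] / prod_a m j.

Definition right_sol m n j : R :=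
  (-1) ^+ j * prod_a m j * (cont (m + j).+1 (n - j)).[0].

Lemma ract_left_sol m x j :
  ract (fun k => a (m + k)%N) (fun k => b (m + k)%N) (left_sol m x) j = x * left_sol m x j.
Proof.
have a0 k : a k != 0 by rewrite gt_eqF.
have P0 := prod_a_neq0; rewrite /ract /left_sol.
case: j => [|j].
  rewrite cont_front cont0 cont1 prod_aS !addn0 /prod_a big_ord0 !(hornerD, hornerN, hornerM, hornerC, hornerX).
  by field; rewrite a0.
rewrite [cont m j.+3]cont_back !prod_aS !(hornerD, hornerN, hornerM, hornerC, hornerX) /= !addnS /= !exprS.
by field; rewrite !a0 P0.
Qed.

Lemma ract_right_sol m n j : (j.+1 < n)%N ->
  ract (fun k => a (m + k)%N) (fun k => b (m + k)%N) (right_sol m n) j.+1 = 0.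
Proof.
move=> jn; rewrite /ract /right_sol; have [l e] : exists l, n = (j + l.+2)%N.
  by exists (n - j.+2)%N; lia.
rewrite (_ : n - j = l.+2)%N; last by lia.
rewrite (_ : n - j.+1 = l.+1)%N; last by lia.
rewrite (_ : n - j.+2 = l)%N; last by lia.
by rewrite cont_front !prod_aS !(hornerD, hornerN, hornerM, hornerC, hornerX) /= !addnS !exprS; ring.
Qed.

Lemma right_sol_end m n : right_sol m n n = 0.
Proof. by rewrite /right_sol subnn cont0 horner0 mulr0. Qed.

(** The Wronskian is [cont_split] for a cut between rows [m + k] and [m + k + 1]: the determinant of
    the whole section, whatever [k] is. *)
Lemma sol_wronskian m n k : (k < n)%N ->
  a (m + k)%N * (left_sol m 0 k * right_sol m n k.+1 - left_sol m 0 k.+1 * right_sol m n k)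
  = (cont m n.+1).[0].
Proof.
move=> kn; have a0 j : a j != 0 by rewrite gt_eqF.
have P0 := prod_a_neq0.
have [l e] : exists l, n = (k.+1 + l)%N by exists (n - k.+1)%N; lia.
rewrite [in RHS]e cont_split /left_sol /right_sol.
rewrite (_ : n - k = l.+1)%N; last by lia.
rewrite (_ : n - k.+1 = l)%N; last by lia.
rewrite !addnS -pred_Sn prod_aS exprS.
move: (cont m k.+2) (cont m k.+1) (cont _ l.+1) (cont _ l) => p q u v.
rewrite !(hornerD, hornerN, hornerM, hornerC).
have s : ((-1) ^+ k) ^+ 2 = 1 :> R by rewrite sqrr_sign.
set s' := (-1) ^+ k in s *.
rewrite [RHS](_ : _ = s' ^+ 2 * (p.[0] * u.[0] - a (m + k)%N ^+ 2 * q.[0] * v.[0])).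
  by field; rewrite a0 P0.
by rewrite s mul1r.
Qed.

(** Entry [(j, k)] of the inverse of the section of size [n] starting at row [m]: the classical
    Green kernel, built from one solution for each end and divided by their Wronskian. *)
Definition green m n k j : R :=
  (if (j <= k)%N then left_sol m 0 j * right_sol m n k
   else left_sol m 0 k * right_sol m n j) / (cont m n.+1).[0].

Lemma ractZ (a' b' : nat -> R) c f j :
  ract a' b' (fun i => c * f i) j = c * ract a' b' f j.
Proof. by rewrite /ract; case: j => [|j]; ring. Qed.

Lemma eq_ract (a' b' : nat -> R) f g j :
  (forall i, (j <= i.+1)%N -> (i <= j.+1)%N -> f i = g i) ->
  ract a' b' f j = ract a' b' g j.
Proof.
move=> fg; rewrite /ract; have -> : f j = g j by apply: fg; lia.
have -> : f j.+1 = g j.+1 by apply: fg; lia.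
by case: j fg => [//|j] fg; have -> : f j = g j by apply: fg; lia.
Qed.

(** Off the diagonal the column is locally a multiple of a single solution; at [j = k] the mismatch
    of the two solutions is exactly the Wronskian. *)
Lemma ract_green m n k j : (cont m n.+1).[0] != 0 -> (k < n)%N -> (j < n)%N ->
  ract (fun k => a (m + k)%N) (fun k => b (m + k)%N) (green m n k) j = (j == k)%:R.
Proof.
move=> W0 kn jn; case: (ltngtP j k) => jk /=.
- rewrite (@eq_ract _ _ _ (fun i => right_sol m n k / (cont m n.+1).[0] * left_sol m 0 i)).
    by rewrite ractZ ract_left_sol mul0r mulr0.
  move=> i _ ij; rewrite /green ifT; last by lia.
  by rewrite -mulrA mulrC.
- rewrite (@eq_ract _ _ _ (fun i => left_sol m 0 k / (cont m n.+1).[0] * right_sol m n i)).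
    by case: j jn jk => // j jn jk; rewrite ractZ ract_right_sol // mulr0.
  move=> i ji _; rewrite /green; case: ifP => ik; last by rewrite mulrAC.
  by rewrite (_ : i = k); [rewrite mulrAC | lia].
subst j; have [c cE] : exists c, c = right_sol m n k / (cont m n.+1).[0] by eexists.
have e i : (i <= k)%N -> green m n k i = c * left_sol m 0 i.
  by move=> ik; rewrite /green ik cE -mulrA mulrC.
have := ract_left_sol m 0 k; rewrite mul0r => h.
have : ract (fun k => a (m + k)%N) (fun k => b (m + k)%N) (fun i => c * left_sol m 0 i) k = 0.
  by rewrite ractZ h mulr0.
rewrite /ract => h1.
have -> : (if k is k'.+1 then a (m + k')%N * green m n k k' else 0) =
    (if k is k'.+1 then a (m + k')%N * (c * left_sol m 0 k') else 0).
  by case: k e {kn jn h h1 cE} => // k e; rewrite e.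
rewrite (e k) //; move: h1; set u := (if _ is _.+1 then _ else _); set v := b _ * _ => h1.
have -> : u + v = - (a (m + k)%N * (c * left_sol m 0 k.+1)).
  by apply/eqP; rewrite -subr_eq0 opprK h1.
rewrite /green ltnn cE -[RHS](divff W0) -[X in _ = X / _](sol_wronskian m kn).
by field.
Qed.

Variables (M : R) (t : nat -> R).
Hypothesis ab_bounds : finite_bounds a b M t.

(** At a root, [left_sol] vanishes at index [n], so its extension by zero is an eigenvector of the
    section, with entry 1 at row [m]. *)
Lemma cont_root_gt0 m n x : root (cont m n.+1) x -> 0 < x.
Proof.
case: n => [|n]; first by rewrite cont1 => h; have := root1 x; rewrite h.
move/rootP => x0; apply: (fb_eigen ab_bounds (g := pad m n.+1 (left_sol m x))).
- exact: finite_pad.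
- move=> _ /pad_neq0[j -> jn]; rewrite ract_pad // ?padE ?jn ?ract_left_sol //.
  by rewrite /left_sol x0 mulr0 mul0r.
exists (m + 0)%N; rewrite padE /left_sol /prod_a big_ord0 cont1 hornerC expr0.
by rewrite !mul1r invr1 oner_eq0.
Qed.

Lemma root_enum_gt0 m n r i : root_enum n (cont m n.+1) r -> (i < n)%N -> 0 < r i.
Proof.
move=> [_ cr] i_n; apply: (@cont_root_gt0 m n); rewrite cr.
apply/rootP; rewrite horner_prod_roots (bigD1 (Ordinal i_n)) //=.
by rewrite subrr mul0r.
Qed.

Lemma cont_at0_gt0 m n : 0 < (cont m n.+1).[0].
Proof.
have [r hr] := cont_roots b a_gt0 m n; have [_ ->] := hr.
rewrite horner_prod_roots; apply: prodr_gt0 => i _; rewrite subr0.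
exact: root_enum_gt0 hr _.
Qed.

Lemma pad_green_ract m n k : (k < n)%N ->
  forall j, pad m n (green m n k) j != 0 ->
  ract a b (pad m n (green m n k)) j = (j == m + k)%N%:R.
Proof.
move=> kn _ /pad_neq0[j -> jn]; rewrite ract_pad //.
  by rewrite ract_green ?eqn_add2l // gt_eqF // cont_at0_gt0.
by rewrite /green ifF ?right_sol_end ?mulr0 ?mul0r //; lia.
Qed.

Lemma green_diag m n k : green m n k k =
  (cont m k.+1).[0] * (cont (m + k).+1 (n - k)).[0] / (cont m n.+1).[0].
Proof.
rewrite /green leqnn /left_sol /right_sol.
have s : ((-1) ^+ k) ^+ 2 = 1 :> R by rewrite sqrr_sign.
have W0 : (cont m n.+1).[0] != 0 by rewrite gt_eqF // cont_at0_gt0.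
have P0 := prod_a_neq0 m k.
rewrite [LHS](_ : _ = ((-1) ^+ k) ^+ 2 * ((cont m k.+1).[0] *
  (cont (m + k).+1 (n - k)).[0] / (cont m n.+1).[0])); first by rewrite s mul1r.
by field; rewrite W0 P0.
Qed.

Lemma green_diag_le m n k : (k < n)%N -> green m n k k <= t (m + k).
Proof.
move=> kn; have := fb_green ab_bounds (finite_pad m n (green m n k)) (pad_green_ract kn).
by rewrite padE kn.
Qed.

Lemma green_first m n j : green m n 0 j = right_sol m n j / (cont m n.+1).[0].
Proof.
have L0 : left_sol m 0 0 = 1.
  by rewrite /left_sol /prod_a big_ord0 cont1 hornerC expr0 mul1r invr1 mulr1.
by rewrite /green leqn0; case: eqP => [->|_]; rewrite L0 mul1r.
Qed.

(** The bound is independent of [n], so it passes to the limit of the first columns and makes that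
    limit square-summable. *)
Lemma green_first_l2 m n N : (0 < n)%N -> (N <= n)%N ->
  \sum_(j < N) green m n 0 j ^+ 2 <= M * t m.
Proof.
move=> n0 Nn; have h := fb_green_l2 ab_bounds (finite_pad m n (green m n 0)) (pad_green_ract n0).
have h0 := green_diag_le m n0; rewrite addn0 in h0 h.
rewrite -[X in pad _ _ _ X]addn0 padE n0 in h.
apply: le_trans (ler_wpM2l (ltW (fb_M ab_bounds)) h0).
apply: le_trans (h (m + N)%N); rewrite (@big_cat_nat _ _ _ m) ?leq_addr //=.
have -> : \sum_(m <= i < m + N) pad m n (green m n 0) i ^+ 2 =
    \sum_(j < N) green m n 0 j ^+ 2.
  rewrite -{1}[m]add0n big_addn addKn big_mkord; apply: eq_bigr => i _.
  by rewrite addnC padE ifT //; have := ltn_ord i; lia.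
by rewrite lerDr sumr_ge0 // => i _; exact: sqr_ge0.
Qed.

(** Both [sum_inv_roots] and [deriv_cont] compute the trace of the inverse section, whose diagonal
    entries are bounded one by one. *)
Lemma sum_inv_roots_le m n r : root_enum n (cont m n.+1) r ->
  \sum_(i < n) (r i)^-1 <= \sum_(k < n) t (m + k).
Proof.
move=> hr; rewrite sum_inv_roots; last first.
  by move=> i i_n; rewrite gt_eqF // (root_enum_gt0 hr).
have [_ <-] := hr; rewrite deriv_cont hornerN opprK horner_sum mulr_suml.
apply: ler_sum => k _; rewrite hornerM -green_diag; exact: green_diag_le.
Qed.

End GreenVectors.

(** * Infinite products *)

Section InfiniteProducts.
Variable R : realType.
Implicit Types (u v l : nat -> R) (z C : R).

Definition fprod l z n : R := \prod_(i < n) (1 - z * l i).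
Definition infprod l z : R := limn (fprod l z).

Lemma fprodS l z n : fprod l z n.+1 = fprod l z n * (1 - z * l n).
Proof. by rewrite /fprod big_ord_recr. Qed.

Lemma norm_factor_le z x y : 0 <= x -> x <= y -> `|1 - z * x| <= expR (`|z| * y).
Proof.
move=> x0 xy; apply: le_trans (ler_normB _ _) _.
rewrite normr1 normrM (ger0_norm x0); apply: le_trans (expR_ge1Dx _).
by rewrite lerD2l ler_wpM2l.
Qed.

Lemma fprod_le l z n : (forall i, 0 <= l i) ->
  `|fprod l z n| <= expR (`|z| * \sum_(i < n) l i).
Proof.
move=> l0; elim: n => [|n IH].
  by rewrite /fprod !big_ord0 mulr0 expR0 normr1.
rewrite fprodS normrM big_ord_recr /= mulrDr expRD.
by apply: ler_pM => //; exact: norm_factor_le.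
Qed.

(** The one estimate behind the dominated convergence, the distance of a product to 1 and the
    nonvanishing of tails; the last two take [u = 0]. *)
Lemma fprod_sub_le u v z n : (forall i, 0 <= u i) -> (forall i, u i <= v i) ->
  `|fprod u z n - fprod v z n| <=
  expR (`|z| * \sum_(i < n) v i) * (`|z| * \sum_(i < n) (v i - u i)).
Proof.
move=> u0 uv; have v0 i : 0 <= v i by apply: le_trans (uv i).
elim: n => [|n IH].
  by rewrite /fprod !big_ord0 subrr normr0 !mulr0.
rewrite !fprodS.
have -> : fprod u z n * (1 - z * u n) - fprod v z n * (1 - z * v n) =
    (1 - z * u n) * (fprod u z n - fprod v z n) + z * (v n - u n) * fprod v z n.
  by ring.
apply: le_trans (ler_normD _ _) _; rewrite !normrM !big_ord_recr /=.
have w0 : 0 <= v n - u n by rewrite subr_ge0.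
rewrite (ger0_norm w0); move: w0; move: (v n - u n) => w w0; rewrite !mulrDr expRD.
have h1 := norm_factor_le z (u0 n) (uv n); have h2 := fprod_le z n v0.
set E := expR (`|z| * \sum_(i < n) v i) in h2 IH *.
have F1 : 1 <= expR (`|z| * v n) by rewrite -expR0 ler_expR mulr_ge0.
set F := expR _ in h1 F1 *; set S := \sum_(i < n) (v i - u i) in IH *.
apply: lerD; first by rewrite (mulrC E) -mulrA; apply: ler_pM.
have E0 : 0 <= E by exact: expR_ge0.
have z0 : 0 <= `|z| * w by rewrite mulr_ge0.
rewrite mulrC; apply: ler_wpM2r => //; apply: le_trans h2 _.
by rewrite ler_peMr.
Qed.

Lemma cvg_fprod l z C : (forall i, 0 <= l i) ->
  (forall n, \sum_(i < n) l i <= C) -> fprod l z @ \oo --> infprod l z.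
Proof.
move=> l0 lC; pose d n := fprod l z n.+1 - fprod l z n.
have e : fprod l z = (fun n => 1 + series d n).
  apply/funext => n; rewrite /series /d /= telescope_sumr //.
  by rewrite [fprod l z 0]/fprod big_ord0 addrC subrK.
suff : cvgn (fprod l z) by [].
rewrite e; apply: is_cvgD; first exact: is_cvg_cst.
apply: (@normed_cvg _ R^o); pose K := expR (`|z| * C) * `|z|.
have K0 : 0 <= K by rewrite mulr_ge0 ?expR_ge0.
apply: (@series_le_cvg _ _ (fun n => K * l n)) => [n|n|n|] /=.
- exact: normr_ge0.
- by rewrite mulr_ge0.
- rewrite /d fprodS -{2}[fprod l z n]mulr1 -mulrBr addrAC subrr add0r.
  rewrite normrM normrN normrM (ger0_norm (l0 n)) mulrA; apply: ler_wpM2r => //.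
  apply: ler_wpM2r => //; apply: le_trans (fprod_le z n l0) _.
  by rewrite ler_expR ler_wpM2l.
apply: nondecreasing_is_cvgn.
  by apply: nondecreasing_series => n _ _; rewrite mulr_ge0.
exists (K * C) => _ [n _ <-]; rewrite /series /= -mulr_sumr big_mkord.
exact: ler_wpM2l.
Qed.

Section Bounded.
Variables (l : nat -> R) (C : R).
Hypothesis l_ge0 : forall i, 0 <= l i.
Hypothesis l_sum : forall n, \sum_(i < n) l i <= C.

Let C_ge0 : 0 <= C.
Proof. by apply: le_trans (l_sum 0); rewrite big_ord0. Qed.

Lemma fprod_sub1_le z n : `|fprod l z n - 1| <=
  expR (`|z| * C) * (`|z| * \sum_(i < n) l i).
Proof.
have e : fprod (fun=> 0) z n = 1 by rewrite /fprod big1 // => i _; rewrite mulr0 subr0.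
rewrite distrC -{1}e; apply: le_trans (fprod_sub_le _ _ _ _) _ => //.
rewrite [X in _ * (_ * X) <= _](eq_bigr (fun i : 'I_n => l i)) => [|i _]; last by rewrite subr0.
by apply: ler_wpM2r; rewrite ?mulr_ge0 ?sumr_ge0 // ler_expR ler_wpM2l.
Qed.

Lemma infprod_le z : `|infprod l z| <= expR (`|z| * C).
Proof.
have h : `|fprod l z n| @[n --> \oo] --> `|infprod l z|.
  by apply: cvg_norm; exact: cvg_fprod l_ge0 l_sum.
rewrite -(cvg_lim (@Rhausdorff R) h); apply: limr_le; first by apply/cvg_ex; eexists; exact: h.
by near=> n; apply: le_trans (fprod_le z n l_ge0) _; rewrite ler_expR ler_wpM2l.
Unshelve. all: by end_near. Qed.

Lemma infprod_sub1_le z : `|infprod l z - 1| <= expR (`|z| * C) * (`|z| * C).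
Proof.
have h : `|fprod l z n - 1| @[n --> \oo] --> `|infprod l z - 1|.
  by apply: cvg_norm; apply: cvgB; [exact: cvg_fprod l_ge0 l_sum | exact: cvg_cst].
rewrite -(cvg_lim (@Rhausdorff R) h); apply: limr_le; first by apply/cvg_ex; eexists; exact: h.
near=> n; apply: le_trans (fprod_sub1_le z n) _.
by rewrite ler_wpM2l ?expR_ge0 // ler_wpM2l.
Unshelve. all: by end_near. Qed.

Lemma cvg_l_sum : (fun n => \sum_(i < n) l i) @ \oo --> limn (series l).
Proof.
have -> : (fun n => \sum_(i < n) l i) = series l.
  by apply/funext => n; rewrite /series /= big_mkord.
suff : cvgn (series l) by [].
apply: nondecreasing_is_cvgn; first by apply: nondecreasing_series.
by exists C => _ [n _ <-]; rewrite /series /= big_mkord.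
Qed.

Lemma l_sum_tail e : 0 < e -> exists K, forall n, \sum_(i < n) l (K + i) <= e.
Proof.
move=> e0; have /cvgrPdist_le /(_ _ e0)[K _ hK] := cvg_l_sum.
exists K => n; have := hK K (leqnn K) => /=.
have cs : cvgn (fun n => \sum_(i < n) l i) by apply/cvg_ex; eexists; exact: cvg_l_sum.
have : \sum_(i < K + n) l i <= limn (series l).
  rewrite -(cvg_lim (@Rhausdorff R) cvg_l_sum); apply: nondecreasing_cvgn_le => //.
  apply/nondecreasing_seqP => m; rewrite big_ord_recr /= lerDl //.
rewrite big_split_ord /= => h1 h2; have := le_trans (ler_norm _) h2; lra.
Qed.

(** If no factor vanishes, the product splits into a nonzero finite part and a tail whose sum is so
    small that its partial products stay above one half. *)
Lemma infprod_eq0 z : infprod l z = 0 <-> exists i, z * l i = 1.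
Proof.
split=> [z0|[i zi]]; last first.
  apply: cvg_lim => //; apply: cvg_near_cst; near=> n.
  have i_n : (i < n)%N by near: n; exists i.+1.
  by rewrite /fprod (bigD1 (Ordinal i_n)) //= zi subrr mul0r.
apply: contrapT => no.
(* A tail product differs from 1 by at most [B] times the tail sum; the summand 1 keeps [B] positive
   when [z = 0]. *)
pose B := expR (`|z| * C) * `|z| + 1.
have B0 : 0 < B by rewrite ltr_wpDl // mulr_ge0 ?expR_ge0.
have [K hK] : exists K, forall n, \sum_(i < n) l (K + i) <= 2^-1 / B.
  by apply: l_sum_tail; rewrite divr_gt0 // invr_gt0.
have PK : fprod l z K != 0.
  apply/prodf_neq0 => i _; apply/eqP => zi; apply: no; exists i; lra.
have tail n : 2^-1 <= `|fprod (fun i => l (K + i)) z n|.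
  have l1 i : 0 <= l (K + i)%N by [].
  have := fprod_sub_le z n (fun i => lexx 0) l1.
  have -> : fprod (fun=> 0) z n = 1 by rewrite /fprod big1 // => i _; rewrite mulr0 subr0.
  rewrite [X in _ * (_ * X)](eq_bigr (fun i : 'I_n => l (K + i)%N)) => [h|i _]; last by rewrite subr0.
  set S := \sum_(i < n) l (K + i)%N in h.
  have S0 : 0 <= S by apply: sumr_ge0.
  have SC : S <= C.
    apply: le_trans (l_sum (K + n)); rewrite big_split_ord /= lerDr.
    exact: sumr_ge0.
  have h1 : expR (`|z| * S) * (`|z| * S) <= 2^-1.
    apply: (@le_trans _ _ (B * S)); last first.
      by rewrite mulrC -ler_pdivlMr //; exact: hK.
    rewrite mulrA; apply: ler_wpM2r => //; rewrite /B.
    have : expR (`|z| * S) * `|z| <= expR (`|z| * C) * `|z|.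
      by rewrite ler_wpM2r // ler_expR ler_wpM2l.
    by lra.
  have := le_trans h h1; have := ler_normB 1 (1 - fprod (fun i => l (K + i)%N) z n).
  by rewrite opprB addrC subrK; have := lerB_dist 1 (fprod (fun i => l (K + i)%N) z n); rewrite normr1; lra.
have h : `|fprod l z n| @[n --> \oo] --> `|infprod l z|.
  by apply: cvg_norm; exact: cvg_fprod l_ge0 l_sum.
have : `|fprod l z K| * 2^-1 <= `|infprod l z|.
  rewrite -(cvg_lim (@Rhausdorff R) h); apply: limr_ge; first by apply/cvg_ex; eexists; exact: h.
  near=> n; have Kn : (K <= n)%N by near: n; exists K.
  rewrite -(subnKC Kn) {2}/fprod big_split_ord normrM.
  by apply: ler_wpM2l => //; exact: tail.
rewrite z0 normr0; have : 0 < `|fprod l z K| by rewrite normr_gt0.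
by lra.
Unshelve. all: by end_near. Qed.

End Bounded.

(** * Dominated convergence of products with increasing inverse roots *)

Section MonotoneLimit.
Variables (mu : nat -> nat -> R) (C : R).
Hypothesis mu_ge0 : forall n i, 0 <= mu n i.
Hypothesis mu_nd : forall n i, mu n i <= mu n.+1 i.
Hypothesis mu_supp : forall n i, (n <= i)%N -> mu n i = 0.
Hypothesis mu_sum : forall n, \sum_(i < n) mu n i <= C.

Definition mulim i : R := limn (mu ^~ i).

Lemma mu_sum_le n N : \sum_(i < N) mu n i <= C.
Proof.
apply: le_trans (mu_sum n).
have [Nn|nN] := leqP N n.
  rewrite -(subnKC Nn) big_split_ord /= lerDl; exact: sumr_ge0.
rewrite -(subnKC (ltnW nN)) big_split_ord /= gerDl big1 // => i _.
by rewrite mu_supp // leq_addr.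
Qed.

Lemma mu_homo i : {homo mu ^~ i : n m / (n <= m)%N >-> n <= m}.
Proof. by apply/nondecreasing_seqP => n. Qed.

Lemma cvg_mu i : mu ^~ i @ \oo --> mulim i.
Proof.
suff : cvgn (mu ^~ i) by [].
apply: nondecreasing_is_cvgn; first exact: mu_homo.
exists C => _ [n _ <-]; apply: le_trans (mu_sum_le n i.+1).
by rewrite big_ord_recr /= lerDr sumr_ge0.
Qed.

Lemma mu_le n i : mu n i <= mulim i.
Proof. by apply: nondecreasing_cvgn_le; [exact: mu_homo | apply/cvg_ex; eexists; exact: cvg_mu]. Qed.

Lemma mulim_ge0 i : 0 <= mulim i.
Proof. exact: le_trans (mu_le 0 i). Qed.

Lemma cvg_mu_sum N : (fun n => \sum_(i < N) mu n i) @ \oo --> \sum_(i < N) mulim i.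
Proof.
elim: N => [|N IH].
  by under eq_fun do rewrite big_ord0; rewrite big_ord0; exact: cvg_cst.
under eq_fun do rewrite big_ord_recr; rewrite big_ord_recr.
by apply: cvgD => //; exact: cvg_mu.
Qed.

Lemma mulim_sum N : \sum_(i < N) mulim i <= C.
Proof.
rewrite -(cvg_lim (@Rhausdorff R) (@cvg_mu_sum N)).
apply: limr_le; first by apply/cvg_ex; eexists; exact: cvg_mu_sum.
by near=> n; exact: mu_sum_le.
Unshelve. all: by end_near. Qed.

Lemma cvg_fprod_mu z : (fun n => fprod (mu n) z n) @ \oo --> infprod mulim z.
Proof.
have hl := cvg_fprod (z := z) mulim_ge0 mulim_sum.
suff h : (fun n => fprod (mu n) z n - fprod mulim z n) @ \oo --> (0 : R).
  have -> : (fun n => fprod (mu n) z n) =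
      (fun n => fprod (mu n) z n - fprod mulim z n + fprod mulim z n).
    by apply/funext => n; rewrite subrK.
  by rewrite -[X in _ --> X]add0r; exact: cvgD.
pose E := expR (`|z| * C) * `|z|.
have E0 : 0 <= E by rewrite mulr_ge0 ?expR_ge0.
have cs := cvg_l_sum mulim_ge0 mulim_sum.
set S := limn _ in cs.
have Sn n : \sum_(i < n) mulim i <= S.
  rewrite -(cvg_lim (@Rhausdorff R) cs).
  apply: (nondecreasing_cvgn_le (u_ := fun n => \sum_(i < n) mulim i)).
    by apply/nondecreasing_seqP => m; rewrite big_ord_recr /= lerDl mulim_ge0.
  by apply/cvg_ex; eexists; exact: cs.
apply/cvgrPdist_le => e e0.
(* One half is spent on the tail of the limit sum beyond [K], the other on the first [K] terms;
   monotonicity in [n] controls the tail of [mu n]. The summand 1 avoids a zero denominator. *)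
have e1 : 0 < e / (E + 1) / 2 by rewrite !divr_gt0 // ltr_wpDl.
have /cvgrPdist_le /(_ _ e1)[K _ /(_ K (leqnn K)) /= hK] := cs.
have /cvgrPdist_le /(_ _ e1) hmu := @cvg_mu_sum K.
near=> n; have Kn : (K <= n)%N by near: n; exists K.
have hn : `|\sum_(i < K) mulim i - \sum_(i < K) mu n i| <= e / (E + 1) / 2 by near: n.
rewrite sub0r normrN.
apply: le_trans (fprod_sub_le z n (mu_ge0 n) (mu_le n)) _.
have D : \sum_(i < n) (mulim i - mu n i) <= e / (E + 1).
  rewrite sumrB; have h1 := Sn n.
  have h2 : \sum_(i < K) mu n i <= \sum_(i < n) mu n i.
    rewrite -(subnKC Kn) big_split_ord /= lerDl.
    by apply: sumr_ge0.
  have h3 := le_trans (ler_norm _) hK; have h4 := le_trans (ler_norm _) hn.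
  by lra.
have D0 : 0 <= \sum_(i < n) (mulim i - mu n i).
  by apply: sumr_ge0 => i _; rewrite subr_ge0 mu_le.
apply: (@le_trans _ _ (E * (e / (E + 1)))); last first.
  by rewrite mulrCA ger_pMr // ler_pdivrMr ?ltr_wpDl // mul1r lerDl.
rewrite mulrA; apply: ler_pM; [by apply: mulr_ge0 => //; exact: expR_ge0 | exact: D0 | | exact: D].
by apply: ler_wpM2r => //; rewrite ler_expR ler_wpM2l // mulim_sum.
Unshelve. all: by end_near. Qed.

End MonotoneLimit.

End InfiniteProducts.

(** * Limits of finite sections *)

Section SectionLimits.
Variables (R : realType) (a b : nat -> R).
Hypothesis a_gt0 : forall n, 0 < a n.
Variables (M : R) (t : nat -> R).
Hypothesis ab_bounds : finite_bounds a b M t.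
Local Notation cont := (cont a b).
Let cgt0 := cont_at0_gt0 a_gt0 ab_bounds.

Definition croots m n : nat -> R := sval (cid (cont_roots b a_gt0 m n)).

Lemma crootsP m n : root_enum n (cont m n.+1) (croots m n).
Proof. exact: svalP (cid (cont_roots b a_gt0 m n)). Qed.

Lemma croots_gt0 m n i : (i < n)%N -> 0 < croots m n i.
Proof. by move=> i_n; exact: (root_enum_gt0 a_gt0 ab_bounds (crootsP m n) i_n). Qed.

(** A root that does not exist yet counts as a root at infinity, which keeps the inverse roots
    increasing in [n]. *)
Definition mu m n i : R := if (i < n)%N then (croots m n i)^-1 else 0.

Lemma mu_ge0 m n i : 0 <= mu m n i.
Proof. by rewrite /mu; case: ifP => // i_n; rewrite invr_ge0 ltW // croots_gt0. Qed.

Lemma mu_supp m n i : (n <= i)%N -> mu m n i = 0.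
Proof. by rewrite /mu ltnNge => ->. Qed.

Lemma mu_nd m n i : mu m n i <= mu m n.+1 i.
Proof.
have [i_n|ni] := ltnP i n; last by rewrite mu_supp // mu_ge0.
have /andP[h _] := cont_interlace_back a_gt0 (crootsP m n) (crootsP m n.+1) i_n.
rewrite /mu i_n ltnS ltnW // lef_pV2 ?posrE ?croots_gt0 //; last exact: leqW.
exact: ltW.
Qed.

Lemma mu_front m n i : mu m n.+1 i.+1 <= mu m.+1 n i <= mu m n.+1 i.
Proof.
have [i_n|ni] := ltnP i n; last by rewrite (@mu_supp m n.+1 i.+1) // (@mu_supp m.+1 n) // lexx mu_ge0.
have /andP[h1 h2] := cont_interlace_front a_gt0 (crootsP m.+1 n) (crootsP m n.+1) i_n.
rewrite /mu i_n !ltnS i_n (ltnW i_n) !lef_pV2 ?posrE ?croots_gt0 //; try exact: leqW.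
by rewrite !ltW.
Qed.

Definition tail_sum m : R := limn (series t) - \sum_(k < m) t k.

Lemma sum_t_le m n : \sum_(k < n) t (m + k) <= tail_sum m.
Proof.
have := nondecreasing_cvgn_le (nondecreasing_series (P := xpredT) (u_ := t) (m := 0)
  (fun k _ _ => fb_t ab_bounds k)) (fb_sum ab_bounds) (m + n).
by rewrite /series /= big_mkord big_split_ord /= /tail_sum lerBrDl.
Qed.

Lemma cvg_tail_sum : tail_sum m @[m --> \oo] --> (0 : R).
Proof.
rewrite -(subrr (limn (series t))); apply: cvgB; first exact: cvg_cst.
have -> : (fun m => \sum_(k < m) t k) = series t.
  by apply/funext => n; rewrite /series /= big_mkord.
exact: fb_sum ab_bounds.
Qed.

Lemma mu_sum m n : \sum_(i < n) mu m n i <= tail_sum m.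
Proof.
apply: le_trans (sum_t_le m n); apply: le_trans (sum_inv_roots_le a_gt0 ab_bounds (crootsP m n)).
by apply: ler_sum => i _; rewrite /mu ltn_ord.
Qed.

(** These turn out to be the inverse eigenvalues of [J^[m]], in decreasing order; see
    [enumerates_lam]. *)
Definition lam m : nat -> R := mulim (mu m).

Definition charf m z : R := infprod (lam m) z.

Lemma lam_ge0 m i : 0 <= lam m i.
Proof. exact: mulim_ge0 (mu_ge0 m) (mu_nd m) (@mu_supp m) (mu_sum m) i. Qed.

Lemma mu_le_lam m n i : mu m n i <= lam m i.
Proof. exact: mu_le (mu_ge0 m) (mu_nd m) (@mu_supp m) (mu_sum m) n i. Qed.

Lemma cvg_mu_lam m i : mu m n i @[n --> \oo] --> lam m i.
Proof. exact: cvg_mu (mu_ge0 m) (mu_nd m) (@mu_supp m) (mu_sum m) i. Qed.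

Lemma lam_sum m n : \sum_(i < n) lam m i <= tail_sum m.
Proof. exact: mulim_sum (mu_ge0 m) (mu_nd m) (@mu_supp m) (mu_sum m) n. Qed.

Lemma lam_gt0 m i : 0 < lam m i.
Proof.
by apply: lt_le_trans (mu_le_lam m i.+1 i); rewrite /mu ltnSn invr_gt0 croots_gt0.
Qed.

Lemma lam_le m i l : (forall n, mu m n i <= l) -> lam m i <= l.
Proof.
move=> h; have c := @cvg_mu_lam m i; rewrite -(cvg_lim (@Rhausdorff R) c).
by apply: limr_le; [apply/cvg_ex; eexists; exact: c | near=> n].
Unshelve. all: by end_near. Qed.

Lemma lam_front m i : lam m i.+1 <= lam m.+1 i <= lam m i.
Proof.
apply/andP; split; apply: lam_le => n.
  apply: le_trans (mu_nd _ _ _) _; have /andP[h _] := mu_front m n i.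
  by apply: le_trans h _; exact: mu_le_lam.
by have /andP[_ h] := mu_front m n i; apply: le_trans h _; exact: mu_le_lam.
Qed.

Definition cratio m z n : R := (cont m n.+1).[z] / (cont m n.+1).[0].

Lemma cratioE m z n : cratio m z n = fprod (mu m n) z n.
Proof.
rewrite /cratio /fprod; have [_ ->] := crootsP m n; rewrite !horner_prod_roots.
rewrite -prodf_div; apply: eq_bigr => i _; rewrite /mu ltn_ord subr0.
by field; rewrite gt_eqF // croots_gt0.
Qed.

Lemma cvg_cratio m z : cratio m z n @[n --> \oo] --> charf m z.
Proof.
under eq_fun do rewrite cratioE.
exact: cvg_fprod_mu (mu_ge0 m) (mu_nd m) (@mu_supp m) (mu_sum m) z.
Qed.

(** The first diagonal entry of the inverse of the section of size [n + 1] starting at row [m]. *)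
Definition rhon m n : R := (cont m.+1 n.+1).[0] / (cont m n.+2).[0].

Lemma rhon_gt0 m n : 0 < rhon m n.
Proof. by rewrite divr_gt0. Qed.

(** The Desnanot-Jacobi identity; both corner minors of the tridiagonal block are the product of its
    off-diagonal entries. The right side is a square, which makes [rhon] nondecreasing. *)
Lemma cont_wronskian m n :
  cont m.+1 n.+1 * cont m n.+1 - cont m.+1 n * cont m n.+2 = (prod_a a m n ^+ 2)%:P.
Proof.
elim: n => [|n IH].
  by rewrite !cont1 cont0 /prod_a big_ord0 mul0r subr0 mulr1 expr1n.
rewrite prod_aS exprMn polyCM -IH [cont m.+1 n.+2]cont_back [cont m n.+3]cont_back.
rewrite !addSn !addnS -!pred_Sn.
move: (cont m.+1 n.+1) (cont m.+1 n) (cont m n.+1) (cont m n.+2) => p q u v.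
by ring.
Qed.

Lemma rhon_nd m n : rhon m n <= rhon m n.+1.
Proof.
rewrite /rhon ler_pdivrMr // mulrAC ler_pdivlMr // -subr_ge0.
have := congr1 (fun p => p.[0]) (cont_wronskian m n.+1).
rewrite hornerD hornerN !hornerM hornerC => h.
by rewrite h sqr_ge0.
Qed.

Lemma rhon_le m n : rhon m n <= t m.
Proof.
have := @green_diag_le _ _ _ a_gt0 _ _ ab_bounds m n.+1 0 (ltn0Sn n).
by rewrite (green_diag a_gt0 ab_bounds) !addn0 subn0 cont1 hornerC mul1r.
Qed.

Definition rho m : R := limn (rhon m).

Lemma cvg_rho m : rhon m n @[n --> \oo] --> rho m.
Proof.
suff : cvgn (rhon m) by [].
apply: nondecreasing_is_cvgn; first by apply/nondecreasing_seqP => n; exact: rhon_nd.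
by exists (t m) => _ [n _ <-]; exact: rhon_le.
Qed.

Lemma rho_gt0 m : 0 < rho m.
Proof.
apply: lt_le_trans (rhon_gt0 m 0) _; apply: nondecreasing_cvgn_le.
  by apply/nondecreasing_seqP => n; exact: rhon_nd.
by apply/cvg_ex; eexists; exact: cvg_rho.
Qed.

Lemma cvgn_shift (k : nat) (f : nat -> R) (l : R) :
  (f n @[n --> \oo] --> l) <-> (f (n + k)%N @[n --> \oo] --> l).
Proof. by rewrite -(cvg_shiftn k). Qed.

Lemma charf_rec m z : charf m z =
  (b m - z) * rho m * charf m.+1 z - a m ^+ 2 * rho m * rho m.+1 * charf m.+2 z.
Proof.
have h1 := (cvgn_shift 2 _ _).1 (@cvg_cratio m z).
have h2 := (cvgn_shift 1 _ _).1 (@cvg_cratio m.+1 z).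
have h3 := @cvg_cratio m.+2 z.
have r1 := (cvgn_shift 1 _ _).1 (@cvg_rho m).
have r2 := @cvg_rho m.+1.
rewrite -(cvg_lim (@Rhausdorff R) h1); apply: cvg_lim => //.
(* Expansion along the first row; the sizes [n + 2], [n + 1], [n] are aligned so that all three
   blocks end at the same row. *)
have -> : (fun n => cratio m z (n + 2)) = (fun n =>
    (b m - z) * rhon m (n + 1) * cratio m.+1 z (n + 1)
    - a m ^+ 2 * rhon m (n + 1) * rhon m.+1 n * cratio m.+2 z n).
  apply/funext => n; rewrite addn2 addn1 /cratio /rhon horner_cont_front.
  have W1 := lt0r_neq0 (cgt0 m n.+2); have W2 := lt0r_neq0 (cgt0 m.+1 n.+1).
  have W3 := lt0r_neq0 (cgt0 m.+2 n); move: W1 W2 W3.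
  move: (cont m n.+3).[0] (cont m.+1 n.+2).[0] (cont m.+2 n.+1).[0] => u v w u0 v0 w0.
  move: (cont m.+1 n.+2).[z] (cont m.+2 n.+1).[z] => p q.
  by field; rewrite u0 v0 w0.
apply: cvgB.
  by apply: cvgM; [apply: cvgM; [exact: cvg_cst | exact: r1] | exact: h2].
apply: cvgM; last exact: h3.
by apply: cvgM; [apply: cvgM; [exact: cvg_cst | exact: r1] | exact: r2].
Qed.

End SectionLimits.

(** * The square-summable solution and the zeros of the limit functions *)

Section JostSolution.
Variables (R : realType) (a b : nat -> R).
Hypothesis a_gt0 : forall n, 0 < a n.
Variables (M : R) (t : nat -> R).
Hypothesis ab_bounds : finite_bounds a b M t.
Local Notation cont := (cont a b).
Local Notation charf := (charf b a_gt0).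
Local Notation rho := (rho a b).
Local Notation rhon := (rhon a b).
Local Notation tail_sum := (tail_sum t).
Let cgt0 := cont_at0_gt0 a_gt0 ab_bounds.

(** The limit of the first columns of the inverse sections; for [m = 0] it is [w_k(0)], by
    [second_kindE]. *)
Definition hsol m k : R := (-1) ^+ k * prod_a a m k * \prod_(i < k.+1) rho (m + i).

Lemma hsol0 m : hsol m 0 = rho m.
Proof. by rewrite /hsol /prod_a big_ord0 big_ord1 !mul1r addn0. Qed.

Lemma hsolS m k : hsol m k.+1 = - a (m + k) * rho (m + k).+1 * hsol m k.
Proof. by rewrite /hsol prod_aS big_ord_recr /= addnS exprS; ring. Qed.

Lemma cvg_rho_prod m k : (cont (m + k).+1 n.+1).[0] / (cont m (n + k).+2).[0]
  @[n --> \oo] --> \prod_(i < k.+1) rho (m + i).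
Proof.
elim: k m => [|k IH] m.
  under eq_fun do rewrite !addn0; rewrite big_ord1 addn0.
  exact: (cvg_rho a_gt0 ab_bounds).
have -> : (fun n => (cont (m + k.+1).+1 n.+1).[0] / (cont m (n + k.+1).+2).[0]) =
    (fun n => rhon m (n + k.+1) *
      ((cont (m.+1 + k).+1 n.+1).[0] / (cont m.+1 (n + k).+2).[0])).
  apply/funext => n; rewrite /rhon (addSnnS m) (addnS n).
  have := lt0r_neq0 (cgt0 m.+1 (n + k).+1); have := lt0r_neq0 (cgt0 m (n + k).+2).
  move: (cont m.+1 _).[0] (cont m _).[0] (cont _ n.+1).[0] => u v w u0 v0.
  by field; rewrite u0 v0.
have -> : \prod_(i < k.+2) rho (m + i) = rho m * \prod_(i < k.+1) rho (m.+1 + i).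
  rewrite big_ord_recl addn0; congr (_ * _).
  by apply: eq_bigr => i _; rewrite lift0 addSnnS.
apply: cvgM; last exact: IH.
exact: ((cvgn_shift k.+1 _ _).1 (cvg_rho a_gt0 ab_bounds (m := m))).
Qed.

Lemma cvg_green_hsol m k : green a b m n 0 k @[n --> \oo] --> hsol m k.
Proof.
(* Enlarging the size by [k + 1] makes the truncated subtraction in [right_sol] exact for every
   [n]. *)
apply/(cvgn_shift k.+1).
have -> : (fun n => green a b m (n + k.+1) 0 k) = (fun n => (-1) ^+ k * prod_a a m k *
    ((cont (m + k).+1 n.+1).[0] / (cont m (n + k).+2).[0])).
  apply/funext => n; rewrite green_first /right_sol addnS mulrA.
  by rewrite (_ : (n + k).+1 - k = n.+1)%N //; lia.
by apply: cvgM; [exact: cvg_cst | exact: cvg_rho_prod].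
Qed.

Lemma sum_hsol_le m N : \sum_(k < N) hsol m k ^+ 2 <= M * t m.
Proof.
have c : \sum_(k < N) green a b m n 0 k ^+ 2 @[n --> \oo] --> \sum_(k < N) hsol m k ^+ 2.
  elim: N => [|N IH].
    by under eq_fun do rewrite big_ord0; rewrite big_ord0; exact: cvg_cst.
  under eq_fun do rewrite big_ord_recr; rewrite big_ord_recr.
  apply: cvgD; first exact: IH.
  by under eq_fun do rewrite expr2; rewrite expr2; apply: cvgM; exact: cvg_green_hsol.
rewrite -(cvg_lim (@Rhausdorff R) c).
apply: limr_le; first by apply/cvg_ex; eexists; exact: c.
near=> n; apply: (green_first_l2 a_gt0 ab_bounds); near: n.
  by exists 1%N.
by exists N.
Unshelve. all: by end_near. Qed.

Lemma tail_sum_le m : tail_sum m <= tail_sum 0.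
Proof.
rewrite /tail_sum big_ord0 subr0 gerBl sumr_ge0 // => i _.
exact: fb_t ab_bounds _.
Qed.

Lemma norm_charf_le m z : `|charf m z| <= expR (`|z| * tail_sum 0).
Proof.
apply: le_trans (infprod_le (lam_ge0 a_gt0 ab_bounds m) (lam_sum a_gt0 ab_bounds m) z) _.
by rewrite ler_expR ler_wpM2l // tail_sum_le.
Qed.

(** The inverse roots of [charf m] sum to at most the tail of the convergent series of [t]. *)
Lemma cvg_charf z : charf m z @[m --> \oo] --> (1 : R).
Proof.
have h : expR (`|z| * tail_sum 0) * `|z| * tail_sum m @[m --> \oo] --> (0 : R).
  rewrite -(mulr0 (expR (`|z| * tail_sum 0) * `|z|)); apply: cvgM; first exact: cvg_cst.
  exact: cvg_tail_sum ab_bounds.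
apply/subr_cvg0; apply/norm_cvg0P.
apply: squeeze_cvgr (@cvg_cst _ _ _ _ _) h; near=> m.
rewrite normr_ge0 /=.
apply: le_trans (infprod_sub1_le (lam_ge0 a_gt0 ab_bounds m) (lam_sum a_gt0 ab_bounds m) z) _.
rewrite mulrA; apply: ler_wpM2r.
  by apply: le_trans (lam_sum a_gt0 ab_bounds m 0); rewrite big_ord0.
by apply: ler_wpM2r => //; rewrite ler_expR ler_wpM2l // tail_sum_le.
Unshelve. all: by end_near. Qed.

(** Two consecutive zeros propagate through [charf_rec], whose last coefficient is nonzero, to all
    larger indices, against the limit 1. *)
Lemma charf_no_common_zero m z : charf m z = 0 -> charf m.+1 z = 0 -> False.
Proof.
move=> h0 h1; have h k : charf (m + k) z = 0 /\ charf (m + k).+1 z = 0.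
  elim: k => [|k [IH0 IH1]]; first by rewrite addn0; split; [exact: h0 | exact: h1].
  rewrite addnS; split; first exact: IH1.
  have := charf_rec a_gt0 ab_bounds (m + k) z.
  rewrite IH0 IH1 mulr0 sub0r => /esym/eqP; rewrite oppr_eq0 !mulf_eq0.
  by rewrite !(gt_eqF (a_gt0 _)) !(gt_eqF (rho_gt0 a_gt0 ab_bounds _)) /= => /eqP.
have c : charf n z @[n --> \oo] --> (0 : R).
  apply: cvg_near_cst; near=> n; have mn : (m <= n)%N by near: n; exists m.
  by rewrite -(subnKC mn); have [] := h (n - m)%N.
have e : (1 : R) = 0.
  by rewrite -(cvg_lim (@Rhausdorff R) c); apply/esym; apply: cvg_lim => //; exact: cvg_charf.
by move: (oner_neq0 R); rewrite e eqxx.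
Unshelve. all: by end_near. Qed.

Definition jost m z k : R := hsol m k * charf (m + k).+1 z.

Lemma jost0_neq0 m z : charf m z = 0 -> jost m z 0 != 0.
Proof.
move=> h0; rewrite /jost hsol0 addn0 mulf_neq0 //.
  by rewrite gt_eqF // (rho_gt0 a_gt0 ab_bounds).
by apply/eqP; exact: charf_no_common_zero h0.
Qed.

(** Through [hsolS], row [k] of the matrix equation is [charf_rec] at [m + k] up to a factor; row 0
    has no left neighbour to absorb [charf m z], which therefore remains. *)
Lemma ract_jost m z k : ract (fun i => a (m + i)) (fun i => b (m + i)) (jost m z) k =
  z * jost m z k + (k == 0)%:R * charf m z.
Proof.
rewrite /ract /jost; case: k => [|k].
  rewrite hsolS hsol0 !addn0 addn1 (charf_rec a_gt0 ab_bounds m) eqxx mul1r add0r.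
  move: (charf m.+1 z) (charf m.+2 z) (rho m) (rho m.+1) (a m) (b m) => *.
  by ring.
rewrite !hsolS !addnS (charf_rec a_gt0 ab_bounds (m + k).+1) eqn0Ngt /= mul0r addr0.
move: (charf (m + k).+2 z) (charf (m + k).+3 z) (hsol m k) => *.
move: (rho (m + k).+1) (rho (m + k).+2) (a (m + k)) (a (m + k).+1) (b (m + k).+1) => *.
by ring.
Qed.

Lemma sum_jost_le m z N : \sum_(k < N) jost m z k ^+ 2 <=
  expR (`|z| * tail_sum 0) ^+ 2 * (M * t m).
Proof.
apply: le_trans (ler_wpM2l (sqr_ge0 _) (sum_hsol_le m N)).
rewrite mulr_sumr; apply: ler_sum => k _; rewrite /jost exprMn mulrC.
apply: ler_wpM2r; first exact: sqr_ge0.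
by rewrite -[leLHS]real_normK ?num_real // ler_pXn2r ?nnegrE ?expR_ge0 // norm_charf_le.
Qed.

(** Limits keep only weak interlacing. Equality would squeeze [lam m.+1 i] to the same value and
    give [charf m] and [charf m.+1] a common zero. *)
Lemma lam_lt m i : lam b a_gt0 m i.+1 < lam b a_gt0 m i.
Proof.
have /andP[h1 h2] := lam_front a_gt0 ab_bounds m i.
rewrite lt_def (le_trans h1 h2) andbT; apply/eqP => e.
have e' : lam b a_gt0 m.+1 i = lam b a_gt0 m i.
  by apply/eqP; rewrite eq_le h2 e h1.
have l0 := lam_gt0 a_gt0 ab_bounds m i.
have z m' : lam b a_gt0 m' i = lam b a_gt0 m i -> charf m' (lam b a_gt0 m i)^-1 = 0.
  move=> em; apply/(infprod_eq0 (lam_ge0 a_gt0 ab_bounds m') (lam_sum a_gt0 ab_bounds m')).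
  by exists i; rewrite em mulVf // gt_eqF.
exact: charf_no_common_zero (z m erefl) (z _ e').
Qed.

Lemma charf_eq0 m z : charf m z = 0 <-> exists i, z = (lam b a_gt0 m i)^-1.
Proof.
have h := infprod_eq0 (lam_ge0 a_gt0 ab_bounds m) (lam_sum a_gt0 ab_bounds m) z.
have l0 i := lt0r_neq0 (lam_gt0 a_gt0 ab_bounds m i).
split=> [/h[i e]|[i ->]]; last by apply/(infprod_eq0 (lam_ge0 a_gt0 ab_bounds m) (lam_sum a_gt0 ab_bounds m)); exists i; rewrite mulVf.
by exists i; apply: (mulIf (l0 i)); rewrite mulVf.
Qed.

End JostSolution.

(** * Eigenvalues and eigenvectors *)

Section EigenvalueEnumeration.
Variable R : realType.

(** An increasing [s] picks its values from [s'] in order, so [s n] is some [s' k] with [n <= k].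
    Used both ways, this makes the enumeration of the eigenvalues unique. *)
Lemma incr_seq_range_le (s s' : nat -> R) : (forall n, s n < s n.+1) ->
  (forall n, s' n < s' n.+1) -> (forall n, exists k, s n = s' k) ->
  forall n, s' n <= s n.
Proof.
move=> hs hs' ss' n; have ms' := (increasing_seqP _).1 hs'.
have ms := (increasing_seqP _).1 hs.
suff [k nk ->] : exists2 k, (n <= k)%N & s n = s' k by rewrite ms'.
elim: n => [|n [k nk e]]; first by have [k ->] := ss' 0%N; exists k.
have [k' e'] := ss' n.+1; exists k' => //; apply: leq_ltn_trans nk _.
by rewrite ltnNge -ms' -e -e' ms -ltnNge.
Qed.

Lemma eigenvalue_seqE (A : operator R) s : enumerates_eigenvalues A s ->
  eigenvalue_seq A = s.
Proof.
move=> hs; rewrite /eigenvalue_seq.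
case: xgetP => [s' _ hs'|/(_ s)]; last by move=> /(_ hs).
have [inc ev] := hs; have [inc' ev'] := hs'.
apply/funext => n; apply/eqP; rewrite eq_le; apply/andP; split.
  apply: incr_seq_range_le => // k.
  have [i /complexI e] := (ev' (s k)%:C).1 ((ev _).2 (ex_intro _ k erefl)).
  by exists i.
apply: incr_seq_range_le => // k.
have [i /complexI e] := (ev (s' k)%:C).1 ((ev' _).2 (ex_intro _ k erefl)).
by exists i.
Qed.

(** Symmetry tested on the pair [x], ['i *: x] isolates [Im zeta * ip x x]. *)
Lemma eigenvector_real a b (zeta : R[i]) x :
  is_eigenvector (jacobi a b) zeta x -> zeta = (Re zeta)%:C.
Proof.
move=> [x0 A]; have [hx hzx _] := A; have e := jacobi_act A.
have hix := l2Z (c := 'i) hx.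
have had : l2 (act a b ('i *: x)) by rewrite actZ -e; exact: l2Z.
have := jacobi_adjoint A hix had; rewrite actZ -e scalerA mulrC -scalerA.
have e1 : ip x ('i *: ('i *: x)) = - ip x x by rewrite -[LHS]opprK -ipiC // ipii.
have e2 : ip x ('i *: x) = 0 by rewrite ipC ipixx.
rewrite (@ipZl _ zeta) // (@ipZr _ zeta) // ipii // e1 e2 !mulr0 !add0r mulrN => h.
have n0 := ip_gt0 hx x0.
have : Im zeta * ip x x = 0 by lra.
move/eqP; rewrite mulf_eq0 (gt_eqF n0) orbF => /eqP.
by case: (zeta) => p q /= ->.
Qed.

Lemma eigenvector_first_neq0 a b (zeta : R[i]) x : (forall n, 0 < a n) ->
  is_eigenvector (jacobi a b) zeta x -> x 0%N != 0.
Proof.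
move=> a_gt0 [x_neq0 A]; have e := jacobi_act A.
apply/negP => /eqP x0; apply: x_neq0; apply/funext => n.
suff [] : x n = 0 /\ x n.+1 = 0 by [].
have aN0 k : (a k)%:C != 0 :> R[i] by rewrite fmorph_eq0 gt_eqF.
elim: n => [|n [h1 h2]]; split => //.
  have := congr1 (@^~ 0%N) e; rewrite /act /GRing.scale /= x0 !mulr0 !add0r scaler0.
  by move/esym/eqP; rewrite mulf_eq0 (negbTE (aN0 _)) /= => /eqP.
have := congr1 (@^~ n.+1) e; rewrite /act /GRing.scale /= h1 h2 !mulr0 !add0r scaler0.
by move/esym/eqP; rewrite mulf_eq0 (negbTE (aN0 _)) /= => /eqP.
Qed.

End EigenvalueEnumeration.

(** * Identification of the eigenvalues and of the characteristic functions *)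

Section Spectrum.
Variables (R : realType) (a b : nat -> R).
Hypothesis a_gt0 : forall n, 0 < a n.
Variables (M : R) (t : nat -> R).
Hypothesis ab_bounds : finite_bounds a b M t.
Hypothesis ab_max : maximal_domain a b.
Local Notation charf := (charf b a_gt0).
Local Notation jost := (jost b a_gt0).
Local Notation lam := (lam b a_gt0).
Local Notation am m := (fun k => a (m + k)%N).
Local Notation bm m := (fun k => b (m + k)%N).

Lemma maximal_domain_shiftn m : maximal_domain (am m) (bm m).
Proof.
elim: m => [//|m IH]; have := maximal_domain_shift IH.
by under eq_fun do rewrite addnS -addSn; under [X in _ _ X]eq_fun do rewrite addnS -addSn.
Qed.

Lemma jacobi_shiftE m : jacobi_shift a b m = jacobi (am m) (bm m).
Proof.
have e (f : nat -> R) : (fun n => f (n + m)%N) = (fun n => f (m + n)%N).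
  by apply/funext => n; rewrite addnC.
by rewrite /jacobi_shift (e a) (e b).
Qed.

Lemma l2_jost m z : l2 (cplx (jost m z)).
Proof.
apply: l2_le => N; apply: le_trans (sum_jost_le a_gt0 ab_bounds m z N).
rewrite /series /= big_mkord; apply: ler_sum => k _.
by rewrite /cip /= mulr0 addr0 expr2.
Qed.

Lemma act_jost m z : act (am m) (bm m) (cplx (jost m z)) =
  z%:C *: cplx (jost m z) + (charf m z)%:C *: basis_vec R 0.
Proof.
rewrite act_cplx; apply/funext => k.
transitivity (z%:C * (jost m z k)%:C + (charf m z)%:C * (k == 0)%:R :> R[i]); last by [].
rewrite /cplx (ract_jost a_gt0 ab_bounds); move: (jost m z k) (charf m z) => u v.
by rewrite rmorphD !rmorphM rmorph_nat [_%:R * _]mulrC.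
Qed.

Lemma jacobi_jost m z : jacobi (am m) (bm m) (cplx (jost m z))
  (z%:C *: cplx (jost m z) + (charf m z)%:C *: basis_vec R 0).
Proof.
rewrite -act_jost; apply: maximal_domain_shiftn; first exact: l2_jost.
rewrite act_jost; apply: l2D; first by apply: l2Z; exact: l2_jost.
by apply: l2Z; exact: l2_basis.
Qed.

Lemma jost_eigenvector m z : charf m z = 0 ->
  is_eigenvector (jacobi (am m) (bm m)) z%:C (cplx (jost m z)).
Proof.
move=> h; split.
  move/(congr1 (@^~ 0%N)) => /complexI /eqP.
  by rewrite (negbTE (jost0_neq0 ab_bounds h)).
by have := jacobi_jost m z; rewrite h scale0r addr0.
Qed.

Lemma eigenvector_charf m z x :
  is_eigenvector (jacobi (am m) (bm m)) z%:C x -> charf m z = 0.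
Proof.
move=> ev; have x0 := eigenvector_first_neq0 (fun k => a_gt0 (m + k)) ev.
have [_ A] := ev; have [hx hzx _] := A.
(* The factor [x 0] makes the real pairing with the defect at [basis_vec R 0] equal to [charf m z]
   times the squared modulus of [x 0]. *)
have hj := @l2_jost m z; have hd := l2Z (c := x 0%N) hj.
have hb := l2_basis R 0.
have ad : act (am m) (bm m) (x 0%N *: cplx (jost m z)) =
    z%:C *: (x 0%N *: cplx (jost m z)) + (charf m z)%:C *: (x 0%N *: basis_vec R 0).
  by rewrite actZ act_jost scalerDr !scalerA ![x 0%N * _]mulrC.
have hxb := l2Z (c := x 0%N) hb.
have had : l2 (act (am m) (bm m) (x 0%N *: cplx (jost m z))).
  by rewrite ad; apply: l2D; apply: l2Z.
have := jacobi_adjoint A hd had; rewrite ad ipDr //; try exact: l2Z.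
rewrite ipRZl // !ipRZr // (@ipZr _ _ _ (basis_vec R 0)) // ip_basisr ip_ibasisr => h.
have : charf m z * (Re (x 0%N) * Re (x 0%N) + Im (x 0%N) * Im (x 0%N)) = 0 by lra.
move/eqP; rewrite mulf_eq0 => /orP[/eqP //|].
rewrite -!expr2 paddr_eq0 ?sqr_ge0 // !sqrf_eq0 => /andP[/eqP h1 /eqP h2].
by move: x0; case: (x 0%N) h1 h2 => p q /= -> ->; rewrite eqxx.
Qed.

Lemma enumerates_lam m :
  enumerates_eigenvalues (jacobi (am m) (bm m)) (fun i => (lam m i)^-1).
Proof.
have l0 i := lam_gt0 a_gt0 ab_bounds m i.
split=> [n|zeta]; first by rewrite ltf_pV2 ?posrE // (lam_lt a_gt0 ab_bounds).
split=> [[x ev]|[i ->]].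
  have e := eigenvector_real ev; rewrite e in ev *; move/eigenvector_charf: ev.
  by move/(charf_eq0 a_gt0 ab_bounds) => [i ->]; exists i.
exists (cplx (jost m (lam m i)^-1)); apply: jost_eigenvector.
by apply/(charf_eq0 a_gt0 ab_bounds); exists i.
Qed.

Lemma char_functionE m z :
  char_function (jacobi_shift a b m) z%:C = (charf m z)%:C.
Proof.
rewrite /char_function jacobi_shiftE (eigenvalue_seqE (enumerates_lam m)).
have e N : \prod_(n < N) (1 - z%:C / ((lam m n)^-1)%:C) = (fprod (lam m) z N)%:C.
  rewrite /fprod rmorph_prod; apply: eq_bigr => i _.
  by rewrite fmorphV invrK rmorphB rmorphM rmorph1.
under eq_fun do rewrite e; apply: lim_complex => /=; last exact: cvg_cst.
exact: cvg_fprod (lam_ge0 a_gt0 ab_bounds m) (lam_sum a_gt0 ab_bounds m).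
Qed.

Lemma charf_at0 m : charf m 0 = 1.
Proof.
have e : fprod (lam m) 0 = (fun=> 1).
  by apply/funext => n; rewrite /fprod big1 // => i _; rewrite mul0r subr0.
transitivity (infprod (lam m) 0); first by [].
by rewrite /infprod e; apply: cvg_lim => //; exact: cvg_cst.
Qed.

(** At [z = 0] all the [charf] are 1, so [jost 0 0] is [hsol] and the Jacobi operator sends it to
    [basis_vec R 0]; injectivity identifies it with the resolvent vector. *)
Lemma second_kindE (T : cseq R -> cseq R) k : is_inverse (jacobi a b) T ->
  second_kind a b k 0 = (hsol a b 0 k)%:C.
Proof.
move=> [_ AT]; have := jacobi_jost 0 0.
rewrite charf_at0 scale0r add0r scale1r => A.
rewrite /second_kind /resolvent.
(* The default value of [xget] is excluded, because [jost 0 0] is a candidate. *)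
case: xgetP => [x _|no]; last first.
  by exfalso; apply: (no (cplx (jost 0 0))); rewrite /= scale0r addr0.
rewrite /= scale0r addr0 => /AT <-; rewrite (AT _ _ A) dot_basis; last exact: l2_jost.
by rewrite /cplx /jost charf_at0 mulr1.
Qed.

End Spectrum.

Unset Implicit Arguments.
Set Strict Implicit.

Theorem corollary2p5 (R : realType) (a b : nat -> R)
    (a_gt0 : forall n, 0 < a n)
    (J_posdef : positive_definite (jacobi a b))
    (J_trace : inverse_trace_class (jacobi a b)) :
  forall zeta : R[i], is_eigenvalue (jacobi a b) zeta ->
    is_eigenvector (jacobi a b) zeta
      (fun k => second_kind a b k 0 *
                char_function (jacobi_shift a b k.+1) zeta).
Proof.
have [M [t ab]] := trace_class_finite_bounds J_posdef J_trace.
have [T [JT _]] := J_trace; have ab_max := inverse_maximal_domain JT.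
move=> zeta [x ev]; have e := eigenvector_real ev; rewrite e in ev *.
have h : charf b a_gt0 0 (complex.Re zeta) = 0 by exact: (eigenvector_charf a_gt0 ab (m := 0) ev).
(* For [m = 0] the shifted coefficients are convertible to [a] and [b]; only the entries of the
   eigenvector remain to be identified. *)
have := jost_eigenvector ab ab_max h; congr is_eigenvector.
apply/funext => k; rewrite (second_kindE a_gt0 ab ab_max k JT) (char_functionE a_gt0 ab ab_max).
by rewrite -rmorphM.
Qed.
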